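(* Let $\mathcal T$ be the set of isomorphism classes of fundamental triplets $(\mathfrak g_0,B_0,(\rho,V))$ over $\mathbb C$ such that the representation $(\rho,V)$ is faithful and such that $\langle\mathfrak g_0.V\rangle=V$ and $\langle\mathfrak g_0.V^*\rangle=V^*$. Let $\mathcal G$ be the set of isomorphism classes of transitive quadratic graded Lie algebras. The map $$\tau:\mathcal T\longrightarrow\mathcal G,\qquad \tau\big(\overline{(\mathfrak g_0,B_0,\rho)}\big)=\overline{(\mathfrak g_{min}(\Gamma(\mathfrak g_0,B_0,\rho)),B)}$$ is a bijection. Here the overline denotes the equivalence class and $B$ is the extended form described in the context.
   Context: All vector spaces and Lie algebras are over $\mathbb C$. A quadratic Lie algebra is a pair $(\mathfrak g_0,B_0)$ where $\mathfrak g_0$ is a finite-dimensional Lie algebra and $B_0$ is a non-degenerate invariant symmetric bilinear form on $\mathfrak g_0$. A fundamental triplet $(\mathfrak g_0,B_0,(\rho,V))$ consists of a quadratic Lie algebra and a finite-dimensional representation $(\rho,V)$ of $\mathfrak g_0$; $(\rho^*,V^* )$ is the contragredient representation. $\langle\mathfrak g_0.V\rangle$ (resp. $\langle\mathfrak g_0.V^*\rangle$) is the subspace generated by all $\rho(U)X$ (resp. $\rho^*(U)Y$). An isomorphism of fundamental triplets $(\mathfrak g_0^1,B_0^1,(\rho_1,V_1))\to(\mathfrak g_0^2,B_0^2,(\rho_2,V_2))$ is a pair $(A,\gamma)$ where $A:\mathfrak g_0^1\to\mathfrak g_0^2$ is an isomorphism of Lie algebras, $\gamma:V_1\to V_2$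 is an isomorphism of vector spaces, $B_0^2(A(U),A(U'))=B_0^1(U,U')$ for all $U,U'\in\mathfrak g_0^1$, and $\rho_2(A(U))\circ\gamma=\gamma\circ\rho_1(U)$ for all $U\in\mathfrak g_0^1$. A graded Lie algebra is a Lie algebra $\mathfrak g=\bigoplus_{i\in\mathbb Z}\mathfrak g_i$ with $\dim\mathfrak g_i<\infty$, $[\mathfrak g_i,\mathfrak g_j]\subset\mathfrak g_{i+j}$, generated by its local part $\mathfrak g_{-1}\oplus\mathfrak g_0\oplus\mathfrak g_1$. A local Lie algebra is a direct sum $\Gamma=\mathfrak g_{-1}\oplus\mathfrak g_0\oplus\mathfrak g_1$ of finite-dimensional spaces with bilinear anticommutative brackets $\mathfrak g_i\times\mathfrak g_j\to\mathfrak g_{i+j}$ for $i,j\in\{-1,0,1\}$ with $|i+j|\le1$, such that the Jacobi identity holds each time its three terms are defined. Morphisms are degree-preserving linear maps compatible with all (defined) brackets. A graded Lie algebra is transitive if: for $x\in\mathfrak g_i$ with $i\ge0$, $[x,\mathfrak g_{-1}]=\{0\}$ implies $x=0$; and for $x\in\mathfrak g_i$ with $i\le0$, $[x,\mathfrak g_1]=\{0\}$ implies $x=0$. A quadratic graded Lie algebra is a pair $(\mathfrak g,B)$ where $\mathfrak g=\bigoplus_{i}\mathfrak g_i$ is a graded Lie algebra and $B$ is a non-degenerate symmetric invariant bilinear form on $\mathfrak g$ such that $B(\mathfrak g_i,\mathfrak g_j)=0$ if $i\ne-j$. An isomorphism $(\mathfrak g^1,B^1)\to(\mathfrak g^2,B^2)$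 of quadratic graded Lie algebras is an isomorphism of graded Lie algebras $\Psi$ with $B^2(\Psi(x),\Psi(y))=B^1(x,y)$ for all $x,y\in\mathfrak g^1$. By a theorem of Kac, for every local Lie algebra $\Gamma$ there is a unique graded Lie algebra $\mathfrak g_{max}(\Gamma)$ with local part $\Gamma$ such that every morphism of local Lie algebras from $\Gamma$ to the local part of a graded Lie algebra extends uniquely to a morphism of graded Lie algebras on $\mathfrak g_{max}(\Gamma)$. It has a unique maximal graded ideal $J_{max}$ with $J_{max}\cap\Gamma=\{0\}$, and $\mathfrak g_{min}(\Gamma):=\mathfrak g_{max}(\Gamma)/J_{max}$, with local part $\Gamma$. $\Gamma(\mathfrak g_0,B_0,\rho)=V^*\oplus\mathfrak g_0\oplus V$ (degrees $-1,0,1$) is the local Lie algebra with the bracket of $\mathfrak g_0$, $[U,X]=\rho(U)X$, $[U,Y]=\rho^*(U)Y$, and $[X,Y]\in\mathfrak g_0$ defined by $B_0([X,Y],U)=Y(\rho(U)X)$ for all $U\in\mathfrak g_0$ ($X\in V$, $Y\in V^*$). The extended form $B$: on $\Gamma(\mathfrak g_0,B_0,\rho)$ let $B$ be the symmetric bilinear form with $B=B_0$ on $\mathfrak g_0\times\mathfrak g_0$, $B(X,Y)=B(Y,X)=Y(X)$ for $X\in V$, $Y\in V^*$, and $B(\mathfrak g_i,\mathfrak g_j)=0$ for $i,j\in\{-1,0,1\}$ with $i+j\ne0$. It is invariant, and extends uniquely to an invariant symmetric bilinear form $B$ on $\mathfrak g_{min}(\Gamma(\mathfrak g_0,B_0,\rho))=\bigoplus_i\mathfrak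 g_i$ such that $B(\mathfrak g_i,\mathfrak g_j)=0$ whenever $i+j\ne0$. *)

(* Defs.v *)
From HB Require Import structures.
From mathcomp Require Import all_boot all_order all_algebra.
From mathcomp Require Import all_classical all_reals.
From mathcomp Require Export complex.

Set Implicit Arguments.
Unset Strict Implicit.
Unset Printing Implicit Defensive.

Import GRing.Theory.
Local Open Scope classical_set_scope.
Local Open Scope ring_scope.

HB.mixin Record Lmodule_isLie (K : fieldType) L of GRing.Lmodule K L := {
  bracket : L -> L -> L;
  bracket_linear_r : forall x, linear (bracket x);
  bracket_linear_l : forall y, linear (fun x => bracket x y);
  bracketxx : forall x, bracket x x = 0;
  bracket_jacobi : forall x y z,
    bracket x (bracket y z) + bracket y (bracket z x)
      + bracket z (bracket x y) = 0
}.

#[short(type="lieType")]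
HB.structure Definition Lie (K : fieldType) :=
  {L of GRing.Lmodule K L & Lmodule_isLie K L}.

#[short(type="finLieType")]
HB.structure Definition FinLie (K : fieldType) :=
  {L of Vector K L & Lmodule_isLie K L}.

Notation "\[ x , y \]" := (bracket x y)
  (at level 0, format "\[  x ,  y  \]") : ring_scope.

Section Subspaces.
Variable K : fieldType.

Definition subspace {L : lmodType K} (A : set L) : Prop :=
  A 0 /\ (forall (a : K) x y, A x -> A y -> A (a *: x + y)).

(* [smallest subspace S] is the linear span of S, so that [fin_dim A] also
   says that A is a subspace. *)
Definition fin_dim (L : lmodType K) (A : set L) : Prop :=
  exists s : seq L, A = smallest subspace [set` s].

(* x is a finite sum of elements of the F i; summands may be 0. *)
Definition is_sum_of (L : lmodType K) (F : int -> set L) (x : L) : Prop :=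
  exists (s : seq int) (c : int -> L),
    (forall i, F i (c i)) /\ x = \sum_(i <- s) c i.

Definition subalgebra {L : lieType K} (A : set L) : Prop :=
  subspace A /\ (forall x y, A x -> A y -> A \[ x, y \]).

End Subspaces.

Arguments subspace {K L} A.
Arguments subalgebra {K L} A.

Section Forms.
Variables (K : fieldType) (L : lieType K) (B : L -> L -> K).

Definition bilinear_form : Prop :=
  (forall x, scalar (B x)) /\ (forall y, scalar (fun x => B x y)).

Definition symmetric_form : Prop := forall x y, B x y = B y x.

Definition invariant_form : Prop :=
  forall x y z, B \[ x, y \] z = B x \[ y, z \].

Definition nondegenerate_form : Prop :=
  forall x, (forall y, B x y = 0) -> x = 0.

End Forms.

Section FundamentalTriplets.
Variable K : fieldType.

Definition dual (V : vectType K) : vectType K := 'Hom(V, K^o).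

Record triplet := Triplet {
  tg0 : finLieType K;
  tB0 : tg0 -> tg0 -> K;
  tV : vectType K;
  trho : tg0 -> 'End(tV);
  tB0_bilinear : bilinear_form tB0;
  tB0_symmetric : symmetric_form tB0;
  tB0_invariant : invariant_form tB0;
  tB0_nondegenerate : nondegenerate_form tB0;
  trho_linear : linear trho;
  trho_bracket : forall u v,
    trho \[ u, v \] = ((trho u \o trho v) - (trho v \o trho u))%VF
}.

Definition contragredient (T : triplet) (u : tg0 T) (Y : dual (tV T)) :
  dual (tV T) := - (Y \o trho u)%VF.

Definition admissible (T : triplet) : Prop :=
  [/\ injective (@trho T),
      smallest subspace [set v : tV T | exists u X, v = trho u X] = setT
    & smallest subspace
        [set w : dual (tV T) | exists u Y, w = contragredient u Y] = setT].

Definition triplet_iso (T1 T2 : triplet) : Prop :=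
  exists (A : tg0 T1 -> tg0 T2) (gamma : tV T1 -> tV T2),
    [/\ linear A /\ linear gamma,
        bijective A /\ bijective gamma,
        forall u v, A \[ u, v \] = \[ A u, A v \],
        forall u v, tB0 (A u) (A v) = tB0 u v
      & forall u X, trho (A u) (gamma X) = gamma (trho u X)].

End FundamentalTriplets.

Section GradedLieAlgebras.
Variable K : fieldType.

Record gradedLie := GradedLie {
  gcarrier :> lieType K;
  gdeg : int -> set gcarrier;
  gdeg_fin_dim : forall i, fin_dim (gdeg i);
  gdeg_span : forall x, is_sum_of gdeg x;
  gdeg_independent : forall (s : seq int) (c : int -> gcarrier),
    uniq s -> (forall i, gdeg i (c i)) -> \sum_(i <- s) c i = 0 ->
    forall i, i \in s -> c i = 0;
  gdeg_bracket : forall i j x y,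
    gdeg i x -> gdeg j y -> gdeg (i + j) \[ x, y \];
  gdeg_generated : smallest subalgebra
    (gdeg (-1) `|` gdeg 0 `|` gdeg 1) = setT
}.

Definition local_part (g : gradedLie) : set g := [set x |
  exists a b c, [/\ gdeg (-1) a, gdeg 0 b, gdeg 1 c & x = a + b + c]].

Definition graded_morphism (g h : gradedLie) (f : g -> h) : Prop :=
  [/\ linear f,
      forall i x, gdeg i x -> gdeg i (f x)
    & forall x y, f \[ x, y \] = \[ f x, f y \]].

Definition graded_ideal (g : gradedLie) (J : set g) : Prop :=
  [/\ subspace J,
      forall x y, J y -> J \[ x, y \]
    & forall x, J x -> is_sum_of (fun i => J `&` gdeg i) x].

Definition transitive_graded (g : gradedLie) : Prop :=
  (forall (i : int) (x : g), 0 <= i -> gdeg i x ->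
     (forall y, gdeg (-1) y -> \[ x, y \] = 0) -> x = 0) /\
  (forall (i : int) (x : g), i <= 0 -> gdeg i x ->
     (forall y, gdeg 1 y -> \[ x, y \] = 0) -> x = 0).

Definition degree_orthogonal (g : gradedLie) (B : g -> g -> K) : Prop :=
  forall (i j : int) (x y : g),
    i <> - j -> gdeg i x -> gdeg j y -> B x y = 0.

Record quadGradedLie := QuadGradedLie {
  qlie :> gradedLie;
  qform : qlie -> qlie -> K;
  qform_bilinear : bilinear_form qform;
  qform_symmetric : symmetric_form qform;
  qform_invariant : invariant_form qform;
  qform_nondegenerate : nondegenerate_form qform;
  qform_orthogonal : degree_orthogonal qform
}.

Definition quad_iso (G1 G2 : quadGradedLie) : Prop :=
  exists Psi : G1 -> G2,
    [/\ graded_morphism Psi, bijective Psi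
      & forall x y, qform (Psi x) (Psi y) = qform x y].

End GradedLieAlgebras.

Section LocalLieAlgebras.
Variable K : fieldType.

(* The brackets g_i x g_0 and g_{-1} x g_1 are determined by anticommutativity.
   The Jacobi identity has its three terms defined exactly in the degrees
   (0,0,0), (0,0,1), (0,0,-1), (0,1,-1) up to order; the first is part of the
   Lie algebra structure of g_0. *)
Record localLie := LocalLie {
  lm1 : vectType K;
  l0 : finLieType K;
  lp1 : vectType K;
  br0m : l0 -> lm1 -> lm1;
  br0p : l0 -> lp1 -> lp1;
  brpm : lp1 -> lm1 -> l0;
  br0m_linear_r : forall u, linear (br0m u);
  br0m_linear_l : forall y, linear (fun u => br0m u y);
  br0p_linear_r : forall u, linear (br0p u);
  br0p_linear_l : forall x, linear (fun u => br0p u x);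
  brpm_linear_r : forall x, linear (brpm x);
  brpm_linear_l : forall y, linear (fun x => brpm x y);
  jacobi00m : forall u v y,
    br0m \[ u, v \] y = br0m u (br0m v y) - br0m v (br0m u y);
  jacobi00p : forall u v x,
    br0p \[ u, v \] x = br0p u (br0p v x) - br0p v (br0p u x);
  jacobi0pm : forall u x y,
    \[ u, brpm x y \] = brpm (br0p u x) y + brpm x (br0m u y)
}.

Record local_map (G : localLie) (T : Type) := LocalMap {
  fm1 : lm1 G -> T;
  f0 : l0 G -> T;
  fp1 : lp1 G -> T
}.

Definition local_map_comp (G : localLie) (S T : Type) (p : S -> T)
  (f : local_map G S) : local_map G T :=
  LocalMap (p \o fm1 f) (p \o f0 f) (p \o fp1 f).

(* f is a morphism from G to the local part of g. *)
Definition local_morphism (G : localLie) (g : gradedLie K)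
    (f : local_map G g) : Prop :=
  [/\ [/\ linear (fm1 f), linear (f0 f) & linear (fp1 f)],
      [/\ forall y, gdeg (-1) (fm1 f y), forall u, gdeg 0 (f0 f u)
        & forall x, gdeg 1 (fp1 f x)]
    & [/\ forall u v, f0 f \[ u, v \] = \[ f0 f u, f0 f v \],
          forall u y, fm1 f (br0m u y) = \[ f0 f u, fm1 f y \],
          forall u x, fp1 f (br0p u x) = \[ f0 f u, fp1 f x \]
        & forall x y, f0 f (brpm x y) = \[ fp1 f x, fm1 f y \]]].

Definition local_isomorphism (G : localLie) (g : gradedLie K)
    (f : local_map G g) : Prop :=
  [/\ local_morphism f, set_bij setT (gdeg (-1)) (fm1 f),
      set_bij setT (gdeg 0) (f0 f) & set_bij setT (gdeg 1) (fp1 f)].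

(* g, with its local part identified with G by iota, is g_max(G). *)
Definition is_gmax (G : localLie) (g : gradedLie K) (iota : local_map G g) :
    Prop :=
  local_isomorphism iota /\
  (forall (h : gradedLie K) (f : local_map G h), local_morphism f ->
     exists! phi : g -> h,
       graded_morphism phi /\ local_map_comp phi iota = f).

Definition is_Jmax (g : gradedLie K) (J : set g) : Prop :=
  let P I := graded_ideal I /\ I `&` @local_part K g = [set 0] in
  P J /\ (forall I, P I -> J `<=` I -> I = J).

(* g is the quotient of g_max(G) by J_max. *)
Definition is_gmin (G : localLie) (g : gradedLie K) (iota : local_map G g) :
    Prop :=
  exists (gM : gradedLie K) (j : local_map G gM) (p : gM -> g),
    [/\ is_gmax j, graded_morphism p, set_surj setT setT p,
        is_Jmax [set x | p x = 0] & iota = local_map_comp p j].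

End LocalLieAlgebras.

Section LocalLieOfTriplet.
Variables (K : fieldType) (T : triplet K).

Local Notation V := (tV T).
Local Notation g0 := (tg0 T).

(* The element [X, Y] of g_0; it exists by [momentE] below. *)
Definition moment (X : V) (Y : dual V) : g0 :=
  xget 0 [set w : g0 | forall u : g0, tB0 w u = Y (trho u X)].

Lemma tB0_inj (w1 w2 : g0) : (forall u, tB0 w1 u = tB0 w2 u) -> w1 = w2.
Proof.
move=> eqB; apply/eqP; rewrite -subr_eq0; apply/eqP.
apply: (@tB0_nondegenerate _ T) => u.
have [_ linl] := tB0_bilinear T.
by rewrite addrC -scaleN1r (linl u) eqB /= mulN1r addNr.
Qed.

Lemma tB0_riesz (phi : g0 -> K) : scalar phi ->
  exists w : g0, forall u : g0, tB0 w u = phi u.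
Proof.
move=> linphi; have [linr linl] := tB0_bilinear T.
pose mk f (Hf : scalar f) : {linear g0 -> K^o} :=
  HB.pack f (GRing.isLinear.Build K g0 K^o *:%R f Hf).
have mkE f (Hf : scalar f) u : linfun (mk f Hf) u = f u by rewrite lfunE.
pose F (w : g0) : dual g0 := linfun (mk _ (linr w)).
have linF : linear F.
  move=> a x y; apply/lfunP => u.
  by rewrite add_lfunE scale_lfunE !mkE (linl u).
pose FL : {linear g0 -> dual g0} :=
  HB.pack F (GRing.isLinear.Build K g0 (dual g0) *:%R F linF).
have kerF : lker (linfun FL) == 0%VS.
  apply/lker0P => x y; rewrite !lfunE /= => /lfunP eqxy.
  by apply: tB0_inj => u; have := eqxy u; rewrite !mkE.
have limF : (limg (linfun FL) = fullv)%VS.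
  apply/eqP; rewrite eqEdim subvf /= limg_dim_eq ?(eqP kerF) ?capv0 //.
  by rewrite !dimvf /dim /= muln1.
have : linfun (mk phi linphi) \in limg (linfun FL) by rewrite limF memvf.
move=> /memv_imgP[w _ /lfunP Ew]; exists w => u.
by have := Ew u; rewrite mkE lfunE mkE.
Qed.

Lemma momentE X Y u : tB0 (moment X Y) u = Y (trho u X).
Proof.
have lin : scalar (fun u : g0 => Y (trho u X)).
  by move=> a v w; rewrite trho_linear add_lfunE scale_lfunE linearP.
have [w Hw] := tB0_riesz lin.
by rewrite /moment; case: xgetP => [? _ -> //|/(_ w)].
Qed.

Lemma contra_linear_r (u : g0) : linear (@contragredient _ T u).
Proof.
move=> a Y1 Y2; apply/lfunP => X; rewrite /contragredient.
by rewrite !(add_lfunE, scale_lfunE, opp_lfunE, comp_lfunE) scalerN opprD.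
Qed.

Lemma contra_linear_l (Y : dual V) : linear (fun u : g0 => contragredient u Y).
Proof.
move=> a u1 u2; apply/lfunP => X; rewrite /contragredient trho_linear.
rewrite !(add_lfunE, scale_lfunE, opp_lfunE, comp_lfunE).
by rewrite linearP opprD scalerN.
Qed.

Lemma trho_linear_vec (u : g0) : linear (trho u : V -> V).
Proof. exact: linearP. Qed.

Lemma trho_linear_lie (X : V) : linear (fun u : g0 => trho u X).
Proof. by move=> a u1 u2; rewrite trho_linear add_lfunE scale_lfunE. Qed.

Lemma moment_linear_r (X : V) : linear (moment X).
Proof.
move=> a Y1 Y2; apply: tB0_inj => u; have [_ linl] := tB0_bilinear T.
by rewrite (linl u) !momentE add_lfunE scale_lfunE.
Qed.

Lemma moment_linear_l (Y : dual V) : linear (fun X : V => moment X Y).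
Proof.
move=> a X1 X2; apply: tB0_inj => u; have [_ linl] := tB0_bilinear T.
by rewrite (linl u) !momentE !linearP.
Qed.

Lemma trho_jacobi (u v : g0) (X : V) :
  trho \[ u, v \] X = trho u (trho v X) - trho v (trho u X).
Proof. by rewrite trho_bracket add_lfunE opp_lfunE !comp_lfunE. Qed.

Lemma contra_jacobi (u v : g0) (Y : dual V) :
  contragredient \[ u, v \] Y
  = contragredient u (contragredient v Y)
    - contragredient v (contragredient u Y).
Proof.
apply/lfunP => X; rewrite /contragredient.
rewrite !(add_lfunE, scale_lfunE, opp_lfunE, comp_lfunE) trho_jacobi.
by rewrite linearB !opprK opprB.
Qed.

Lemma moment_jacobi (u : g0) (X : V) (Y : dual V) :
  \[ u, moment X Y \]
  = moment (trho u X) Y + moment X (contragredient u Y).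
Proof.
apply: tB0_inj => v; have [_ linl] := tB0_bilinear T.
rewrite -[moment (trho u X) Y]scale1r (linl v) mul1r !momentE.
rewrite /contragredient opp_lfunE comp_lfunE.
rewrite tB0_symmetric -tB0_invariant tB0_symmetric momentE trho_jacobi.
by rewrite linearB.
Qed.

(* The local Lie algebra Gamma(g_0, B_0, rho). *)
Definition Gamma : localLie K :=
  @LocalLie K (dual V) g0 V
    (fun u Y => contragredient u Y) (fun u X => trho u X) moment
    contra_linear_r contra_linear_l trho_linear_vec trho_linear_lie
    moment_linear_r moment_linear_l contra_jacobi trho_jacobi moment_jacobi.

(* B is the extension to g of the form on Gamma; the values of B between
   degrees i and j with i + j <> 0 are fixed by [degree_orthogonal]. *)
Definition extended_form (g : gradedLie K) (iota : local_map Gamma g)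
    (B : g -> g -> K) : Prop :=
  [/\ bilinear_form B, symmetric_form B, invariant_form B,
      degree_orthogonal B
    & (forall u v : g0, B (f0 iota u) (f0 iota v) = tB0 u v) /\
      (forall (X : V) (Y : dual V), B (fp1 iota X) (fm1 iota Y) = Y X)].

(* G is (a model of) the pair (g_min(Gamma), B). *)
Definition is_gmin_with_form (G : quadGradedLie K) : Prop :=
  exists iota : local_map Gamma G,
    is_gmin iota /\ extended_form iota (@qform _ G).

End LocalLieOfTriplet.

Section IsomorphismClasses.
Variable K : fieldType.

(* Isomorphism classes are represented by predicates T -> Prop rather than by
   [set T]: triplets and graded Lie algebras live in too large a universe. *)
Definition triplet_classes : Type :=
  {c : triplet K -> Prop |
    exists2 T : triplet K, admissible T & c = triplet_iso T}.

Definition graded_classes : Type :=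
  {c : quadGradedLie K -> Prop |
    exists2 G : quadGradedLie K, transitive_graded G & c = quad_iso G}.

Definition triplet_class (T : triplet K) (hT : admissible T) :
    triplet_classes :=
  exist _ (triplet_iso T) (ex_intro2 _ _ T hT erefl).

Definition graded_class (G : quadGradedLie K) (hG : transitive_graded G) :
    graded_classes :=
  exist _ (quad_iso G) (ex_intro2 _ _ G hG erefl).

End IsomorphismClasses.

(* Main.v *)
From HB Require Import structures.
From mathcomp Require Import all_boot all_algebra all_reals.
From mathcomp Require Import complex.
From mathcomp Require Import all_classical zify.
Require Import Defs.

(** The inverse of tau sends a transitive quadratic graded Lie algebra G to its
    degrees 0 and 1 with the restriction of the form (triplet_of_algebra). The
    form identifies degree -1 with the dual of degree 1, transitivity gives the
    three admissibility conditions, and an isomorphism of quadratic graded Lie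
    algebras restricts to one of triplets (triplet_iso_local). So everything
    rests on two facts: an admissible triplet has a transitive minimal algebra
    with an extended form (gmin_exists), and this algebra is isomorphic to any
    transitive quadratic algebra with the same local part (gmin_unique). The
    argument works over an arbitrary field.

    Existence of the maximal algebra (gmax_exists). Take formal Lie expressions
    in the elements of the local part, and identify two of them when they agree
    in every model, a model being a Lie algebra with independent homogeneous
    subspaces that receives a morphism from the local part. The universal
    property is then immediate, and the independence of the degrees is inherited
    from the models. That the local part does not get larger follows from the
    description of the generated algebra by iterated brackets
    (tower_deg_bracket). That it does not collapse requires one model in which
    it embeds: its action by operators on the tensor algebra of the dual of V
    with coefficients in V, a generalised Verma module (faithful_local_model).
    Admissibility is what makes this action faithful.

    The form (word_invariance, extension). The local form beta satisfies
      beta(p, [t_1, [t_2, ... [t_m, q]]]) = beta([[[p, t_1], t_2], ... t_m], q)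
    for local elements, by induction on m: commuting two letters whose bracket
    is local costs a word of length m - 1, and when all letters have the same nonzero
    degree as q both sides vanish. Hence for each x there is exactly one functional
    B(x, .) whose value at [t_1, ... [t_m, q]] is
    beta([[x, t_1], ... t_m], q), and the invariance of B is read off from this
    formula.

    The minimal algebra. Dividing the maximal algebra by the radical of B gives
    a non-degenerate form, and non-degeneracy together with admissibility gives
    transitivity (nondegenerate_transitive). The kernel of any surjection onto a
    transitive algebra contains every graded ideal that misses the local part
    (transitive_kernel_contains): brackets with degree -1 or 1 lead from such an
    ideal down to the local part. So the radical is J_max, and two transitive
    algebras with the same local part are quotients of the maximal algebra by
    the same ideal. Their forms agree because B([a, z], y) = B(a, [z, y])
    reduces an invariant form to its values on the local part
    (invariant_form_local_eq0). *)

Import GRing.Theory.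
Local Open Scope ring_scope.

Set Implicit Arguments.
Unset Strict Implicit.
Unset Printing Implicit Defensive.

(** * Linear maps, subspaces and brackets *)

Section LinearMaps.
Variables (K : fieldType) (U V : lmodType K) (f : U -> V).
Hypothesis lf : linear f.

Lemma linD x y : f (x + y) = f x + f y.
Proof. by have := lf 1 x y; rewrite !scale1r. Qed.

Lemma lin0 : f 0 = 0.
Proof. by apply: (addrI (f 0)); rewrite -linD !addr0. Qed.

Lemma linZ a x : f (a *: x) = a *: f x.
Proof. by have := lf a x 0; rewrite lin0 !addr0. Qed.

Lemma linN x : f (- x) = - f x.
Proof. by rewrite -scaleN1r linZ scaleN1r. Qed.

Lemma linB x y : f (x - y) = f x - f y.
Proof. by rewrite linD linN. Qed.

Lemma lin_sum I (s : seq I) (P : pred I) (c : I -> U) :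
  f (\sum_(i <- s | P i) c i) = \sum_(i <- s | P i) f (c i).
Proof. by apply: (big_morph f linD lin0). Qed.

End LinearMaps.

Lemma linear_comp (K : fieldType) (U V W : lmodType K) (f : V -> W) (h : U -> V) :
  linear f -> linear h -> linear (f \o h).
Proof. by move=> lf lh a x y /=; rewrite lh lf. Qed.

Lemma inverse_linear (K : fieldType) (U V : lmodType K) (f : U -> V) (f' : V -> U) :
  linear f -> cancel f f' -> cancel f' f -> linear f'.
Proof. by move=> lf fK f'K a x y; apply: (can_inj fK); rewrite lf !f'K. Qed.

Section SubspaceTheory.
Variable K : fieldType.
Implicit Type L : lmodType K.

Section Closure.
Variables (L : lmodType K) (A : set L).
Hypothesis sA : subspace A.

Lemma subspace0 : A 0. Proof. by case: sA. Qed.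

Lemma subspaceD x y : A x -> A y -> A (x + y).
Proof. by case: sA => _ h /(h 1 x y); rewrite scale1r; apply. Qed.

Lemma subspaceZ a x : A x -> A (a *: x).
Proof. by case: sA => A0 h /(h a x 0); rewrite addr0; apply. Qed.

Lemma subspaceN x : A x -> A (- x).
Proof. by rewrite -scaleN1r; apply: subspaceZ. Qed.

Lemma subspaceB x y : A x -> A y -> A (x - y).
Proof. by move=> Ax Ay; apply/subspaceD => //; apply: subspaceN. Qed.

Lemma subspace_sum I (s : seq I) (P : pred I) (c : I -> L) :
  (forall i, P i -> A (c i)) -> A (\sum_(i <- s | P i) c i).
Proof. by move=> Ac; apply: big_ind => //; [exact: subspace0|exact: subspaceD]. Qed.

End Closure.

Definition lspan L (S : set L) : set L := smallest subspace S.

Lemma lspan_subspace L (S : set L) : subspace (lspan S).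
Proof.
split=> [M [[]]//|a x y Sx Sy M [sM SM]].
by case: (sM) => _; apply; [apply: Sx|apply: Sy].
Qed.

Lemma lspan_min L (S A : set L) : subspace A -> (S `<=` A)%classic -> (lspan S `<=` A)%classic.
Proof. by move=> sA SA; apply: smallest_sub. Qed.

Lemma mem_lspan L (S : set L) x : S x -> lspan S x.
Proof. by move=> Sx M [_]; apply. Qed.

Lemma lspanS L (S S' : set L) : (S `<=` S')%classic -> (lspan S `<=` lspan S')%classic.
Proof.
move=> SS; apply: lspan_min; first exact: lspan_subspace.
by move=> x /SS; apply: mem_lspan.
Qed.

Lemma preimage_subspace L L' (f : L -> L') (A : set L') :
  linear f -> subspace A -> subspace (f @^-1` A)%classic.
Proof.
move=> lf [A0 hA]; split=> [|a x y] /=; first by rewrite (lin0 lf).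
by rewrite lf; apply: hA.
Qed.

Lemma image_subspace L L' (f : L -> L') (A : set L) :
  linear f -> subspace A -> subspace (f @` A)%classic.
Proof.
move=> lf [A0 hA]; split=> [|a _ _ [x Ax <-] [y Ay <-]].
  by exists 0 => //; apply: (lin0 lf).
by exists (a *: x + y); [apply: hA|rewrite lf].
Qed.

Lemma image_lspan L L' (f : L -> L') (S : set L) :
  linear f -> (f @` (lspan S))%classic = lspan (f @` S)%classic.
Proof.
move=> lf; apply/seteqP; split=> [_ [x Sx <-]|].
  suff: (lspan S `<=` f @^-1` (lspan (f @` S)))%classic by apply.
  apply: lspan_min; first by apply: preimage_subspace => //; apply: lspan_subspace.
  by move=> y Sy; apply: mem_lspan; exists y.
apply: lspan_min; first by apply: image_subspace => //; apply: lspan_subspace.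
by move=> _ [x Sx <-]; exists x => //; apply: mem_lspan.
Qed.

Lemma fin_dim_subspace L (A : set L) : fin_dim A -> subspace A.
Proof. by case=> s ->; apply: lspan_subspace. Qed.

Lemma fin_dim_image L L' (f : L -> L') (A : set L) :
  linear f -> fin_dim A -> fin_dim (f @` A)%classic.
Proof.
move=> lf [s ->]; exists [seq f x | x <- s].
rewrite (image_lspan _ lf); congr smallest; apply/seteqP; split.
  by move=> _ [x xs <-] /=; apply/mapP; exists x.
by move=> y /= /mapP[x xs ->]; exists x.
Qed.

Lemma fin_dim_range (V : vectType K) L (f : V -> L) :
  linear f -> fin_dim (range f)%classic.
Proof.
move=> lf; apply: fin_dim_image => //; exists (vbasis fullv).
apply/esym/seteqP; split=> // v _.
have -> : v = \sum_i coord (vbasis fullv) i v *: (vbasis fullv)`_i.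
  by apply: coord_vbasis; apply: memvf.
apply: (subspace_sum (lspan_subspace _)) => i _.
apply: (subspaceZ (lspan_subspace _)); apply: mem_lspan => /=.
by apply: mem_nth; rewrite size_tuple.
Qed.

End SubspaceTheory.

Section LieTheory.
Variables (K : fieldType) (L : lieType K).
Implicit Types (x y z : L) (A B : set L).

Lemma br_linl y : linear (fun x => \[x, y\]).
Proof. exact: bracket_linear_l. Qed.

Lemma br_linr x : linear (fun y => \[x, y\]).
Proof. exact: bracket_linear_r. Qed.

Lemma brDl x x' y : \[x + x', y\] = \[x, y\] + \[x', y\].
Proof. exact: (linD (br_linl y)). Qed.

Lemma brDr x y y' : \[x, y + y'\] = \[x, y\] + \[x, y'\].
Proof. exact: (linD (br_linr x)). Qed.

Lemma br0l y : \[0, y\] = 0. Proof. exact: (lin0 (br_linl y)). Qed.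
Lemma br0r x : \[x, 0\] = 0. Proof. exact: (lin0 (br_linr x)). Qed.
Lemma brNl x y : \[- x, y\] = - \[x, y\]. Proof. exact: (linN (br_linl y)). Qed.
Lemma brNr x y : \[x, - y\] = - \[x, y\]. Proof. exact: (linN (br_linr x)). Qed.

Lemma br_anti x y : \[x, y\] = - \[y, x\].
Proof.
apply/eqP; rewrite -addr_eq0; have /eqP := bracketxx (x + y).
by rewrite brDl !brDr !bracketxx add0r addr0.
Qed.

Lemma br_leibniz x y z : \[x, \[y, z\]\] = \[\[x, y\], z\] + \[y, \[x, z\]\].
Proof.
have /eqP := bracket_jacobi x y z; rewrite -addrA addr_eq0 => /eqP ->.
by rewrite opprD addrC [\[\[x, y\], z\]]br_anti [\[x, z\]]br_anti brNr.
Qed.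

End LieTheory.

(** * Finite sums of homogeneous elements *)

Section SumsOf.
Variables (K : fieldType) (L : lmodType K).
Implicit Type F : int -> set L.

Lemma sum_extend_support (s t : seq int) (c : int -> L) :
  uniq s -> uniq t -> {subset s <= t} -> (forall i, i \notin s -> c i = 0) ->
  \sum_(i <- t) c i = \sum_(i <- s) c i.
Proof.
move=> us ut st c0; rewrite (bigID (mem s)) /= [X in _ + X]big1 // addr0.
rewrite -big_filter; apply: perm_big; apply: uniq_perm => //.
  exact: filter_uniq.
by move=> i; rewrite mem_filter; case: (boolP (i \in s)) => //= /st ->.
Qed.

Lemma is_sum_ofP F x : (forall i, subspace (F i)) -> is_sum_of F x ->
  exists (s : seq int) (c : int -> L), [/\ uniq s, forall i, F i (c i),
    forall i, i \notin s -> c i = 0 & x = \sum_(i <- s) c i].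
Proof.
move=> sF [s [c [Fc ->]]].
exists (undup s), (fun i => if i \in s then c i *+ count_mem i s else 0).
split.
- exact: undup_uniq.
- move=> i; case: ifP => _; last exact: subspace0.
  by rewrite -scaler_nat; apply: subspaceZ.
- by move=> i; rewrite mem_undup => /negbTE ->.
rewrite -big_undup_iterop_count big_seq [RHS]big_seq.
by apply: eq_bigr => i; rewrite mem_undup => ->.
Qed.

Lemma is_sum_of_subspace F : (forall i, subspace (F i)) ->
  subspace [set x | is_sum_of F x]%classic.
Proof.
move=> sF; split=> [|a x y /= /(is_sum_ofP sF)[s [c [us Fc c0 ->]]]].
  by exists [::], (fun=> 0); split=> [i|]; [exact: subspace0|rewrite big_nil].
move=> /(is_sum_ofP sF)[t [d [ut Fd d0 ->]]].
exists (undup (s ++ t)), (fun i => a *: c i + d i); split=> [i|].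
  by apply: subspaceD => //; apply: subspaceZ.
rewrite big_split -scaler_sumr /=; congr (_ *: _ + _); apply/esym.
  by apply: sum_extend_support; rewrite ?undup_uniq // => i;
     rewrite mem_undup mem_cat => ->.
by apply: sum_extend_support; rewrite ?undup_uniq // => i;
   rewrite mem_undup mem_cat => ->; rewrite orbT.
Qed.

Lemma mem_is_sum_of F i x : (forall i, subspace (F i)) -> F i x -> is_sum_of F x.
Proof.
move=> sF Fx; exists [:: i], (fun j => if j == i then x else 0).
split=> [j|]; last by rewrite big_seq1 eqxx.
by case: eqP => [->|_] //; apply: subspace0.
Qed.

End SumsOf.

(** * The Lie algebra generated by a local part *)

Section Towers.
Variables (K : fieldType) (L : lieType K).
Implicit Types (A B C : set L) (x y z : L).

Definition brackets_of A B : set L :=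
  [set z | exists a b, [/\ A a, B b & z = \[a, b\]]]%classic.

(** Right-nested brackets of n.+1 elements of A. *)
Fixpoint tower A (n : nat) : set L :=
  if n is n'.+1 then lspan (brackets_of A (tower A n')) else A.

Lemma tower_subspace A n : subspace A -> subspace (tower A n).
Proof. by case: n => //= n _; apply: lspan_subspace. Qed.

Lemma fin_dim_brackets A B :
  fin_dim A -> fin_dim B -> fin_dim (lspan (brackets_of A B)).
Proof.
move=> [s ->] [t ->]; exists [seq \[a, b\] | a <- s, b <- t].
apply/seteqP; split; last first.
  apply: lspanS => z /= /allpairsP[[a b] /= [sa tb ->]].
  by exists a, b; split => //; apply: mem_lspan.
apply: lspan_min; first exact: lspan_subspace.
move=> _ [a [b [sa tb ->]]]; move: a sa b tb.
set T := smallest subspace [set` [seq _ | a <- _, b <- _]]%classic.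
have sT : subspace T by apply: lspan_subspace.
suff h b : lspan [set` t]%classic b -> (lspan [set` s] `<=` (fun a => \[a, b\]) @^-1` T)%classic.
  by move=> a sa b tb; exact: (h b tb a sa).
move=> tb; apply: lspan_min; first by apply: preimage_subspace => //; apply: br_linl.
move=> a /= sa; suff: (lspan [set` t] `<=` bracket a @^-1` T)%classic by apply.
apply: lspan_min; first by apply: preimage_subspace => //; apply: br_linr.
by move=> c /= tc; apply: mem_lspan; apply/allpairsP; exists (a, c).
Qed.

Lemma fin_dim_tower A n : fin_dim A -> fin_dim (tower A n).
Proof. by move=> fA; elim: n => //= n; apply: fin_dim_brackets. Qed.

Lemma lspan_brackets_ind A B C x : subspace C ->
  (forall a b, A a -> B b -> C \[x, \[a, b\]\]) ->
  forall z, lspan (brackets_of A B) z -> C \[x, z\].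
Proof.
move=> sC h; suff: (lspan (brackets_of A B) `<=` bracket x @^-1` C)%classic by [].
apply: lspan_min; first by apply: preimage_subspace => //; apply: br_linr.
by move=> _ [a [b [Aa Bb ->]]]; apply: h.
Qed.

(** The Leibniz rule moves elements of A0 and C through the nested brackets.
    Both sides of the grading are instances: A is the part of degree 1 or -1 and
    C the opposite one. *)
Lemma tower_down A A0 C :
  subspace A -> subspace A0 ->
  (forall u a, A0 u -> A a -> A \[u, a\]) ->
  (forall c a, C c -> A a -> A0 \[c, a\]) ->
  forall n,
  (forall u z, A0 u -> tower A n z -> tower A n \[u, z\]) /\
  (forall c z, C c -> tower A n.+1 z -> tower A n \[c, z\]).
Proof.
move=> sA sA0 h0 hC; elim=> [|n [IH0 IHC]]; split=> //.
- move=> c z Cc; apply: lspan_brackets_ind => // a b Aa Ab.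
  rewrite br_leibniz; apply: (subspaceD sA).
    by apply: h0 => //; apply: hC.
  by rewrite br_anti; apply: (subspaceN sA); apply: h0 => //; apply: hC.
- move=> u z A0u; apply: lspan_brackets_ind; first exact: lspan_subspace.
  move=> a b Aa Ab; rewrite br_leibniz.
  apply: (subspaceD (lspan_subspace _)); apply: mem_lspan.
    by exists \[u, a\], b; split => //; apply: h0.
  by exists a, \[u, b\]; split => //; apply: IH0.
move=> c z Cc; apply: lspan_brackets_ind; first exact: lspan_subspace.
move=> a b Aa Ab; rewrite br_leibniz; apply: (subspaceD (lspan_subspace _)).
  have A0ca : A0 \[c, a\] by apply: hC.
  have: tower A n.+1 b by [].
  rewrite -/(tower A n.+1).
  move: b {Ab}; apply: lspan_brackets_ind; first exact: lspan_subspace.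
  move=> a' b' Aa' Ab'; rewrite br_leibniz.
  apply: (subspaceD (lspan_subspace _)); apply: mem_lspan.
    by exists \[\[c, a\], a'\], b'; split => //; apply: h0.
  by exists a', \[\[c, a\], b'\]; split => //; apply: IH0.
by apply: mem_lspan; exists a, \[c, b\]; split => //; apply: IHC.
Qed.

Section LocalPart.
Variables Am A0 Ap : set L.
Hypotheses (sAm : subspace Am) (sA0 : subspace A0) (sAp : subspace Ap).
Hypotheses (h00 : forall u v, A0 u -> A0 v -> A0 \[u, v\])
  (h0m : forall u y, A0 u -> Am y -> Am \[u, y\])
  (h0p : forall u x, A0 u -> Ap x -> Ap \[u, x\])
  (hpm : forall x y, Ap x -> Am y -> A0 \[x, y\]).

Definition tower_deg (i : int) : set L :=
  match i with
  | Posz 0 => A0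
  | Posz n.+1 => tower Ap n
  | Negz n => tower Am n
  end.

Lemma tower_deg_subspace i : subspace (tower_deg i).
Proof. by case: i => [[//|n]|n]; apply: tower_subspace. Qed.

Lemma bracket_mp x y : Am y -> Ap x -> A0 \[y, x\].
Proof. by move=> Ay Ax; rewrite br_anti; apply: subspaceN => //; apply: hpm. Qed.

Lemma tower_deg_br0 u i z : A0 u -> tower_deg i z -> tower_deg i \[u, z\].
Proof.
case: i => [[|n]|n] /=; first exact: h00.
  by apply: (tower_down sAp sA0 h0p (fun c a => @bracket_mp a c) n).1.
by apply: (tower_down sAm sA0 h0m hpm n).1.
Qed.

Lemma tower_deg_brp a i z : Ap a -> tower_deg i z -> tower_deg (1 + i) \[a, z\].
Proof.
case: i => [[|n]|[|n]] Aa z_i.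
- by rewrite addr0 br_anti; apply: subspaceN => //; apply: h0p.
- by apply: mem_lspan; exists a, z.
- exact: hpm.
have -> : 1 + Negz n.+1 = Negz n by lia.
exact: (tower_down sAm sA0 h0m hpm n).2.
Qed.

Lemma tower_deg_brm a i z : Am a -> tower_deg i z -> tower_deg (-1 + i) \[a, z\].
Proof.
case: i => [[|[|n]]|n] Aa z_i.
- by rewrite addr0 br_anti; apply: subspaceN => //; apply: h0m.
- exact: bracket_mp.
- have -> : -1 + Posz n.+2 = Posz n.+1 by lia.
  exact: (tower_down sAp sA0 h0p (fun c a => @bracket_mp a c) n).2.
have -> : -1 + Negz n = Negz n.+1 by lia.
by apply: mem_lspan; exists a, z.
Qed.

(** By the Jacobi identity, the elements whose bracket raises degrees by a fixed
    amount behave like the homogeneous elements of a graded Lie algebra, so it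
    suffices to look at the local part. *)
Lemma tower_deg_bracket i j x y :
  tower_deg i x -> tower_deg j y -> tower_deg (i + j) \[x, y\].
Proof.
pose S k : set L :=
  [set x | forall j y, tower_deg j y -> tower_deg (k + j) \[x, y\]]%classic.
have sS k : subspace (S k).
  split=> [l z z_l|a u v Su Sv l z z_l].
    by rewrite br0l; apply: subspace0; apply: tower_deg_subspace.
  rewrite br_linl; have sd := tower_deg_subspace (k + l).
  by apply: subspaceD => //; [apply: subspaceZ => //; apply: Su|apply: Sv].
have hS k l : (brackets_of (S k) (S l) `<=` S (k + l))%classic.
  move=> _ [a [b [Sa Sb ->]]] m z z_m.
  have -> : \[\[a, b\], z\] = \[a, \[b, z\]\] - \[b, \[a, z\]\].
    by rewrite br_leibniz addrK.
  apply: subspaceB; first exact: tower_deg_subspace.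
    by rewrite -addrA; apply: Sa; apply: Sb.
  by rewrite (addrC k) -addrA; apply: Sb; apply: Sa.
have Sp a : Ap a -> S 1 a by move=> Aa l z; apply: tower_deg_brp.
have Sm a : Am a -> S (-1) a by move=> Aa l z; apply: tower_deg_brm.
suff dS k : (tower_deg k `<=` S k)%classic by move=> /dS; apply.
case: k => [[|n]|n].
- by move=> u A0u l z; rewrite add0r; apply: tower_deg_br0.
- elim: n => [|n IH]; first exact: Sp.
  apply: lspan_min => // _ [a [b [Aa Ab ->]]].
  have -> : Posz n.+2 = 1 + Posz n.+1 by lia.
  by apply: hS; exists a, b; split => //; [apply: Sp|apply: IH].
elim: n => [|n IH]; first exact: Sm.
apply: lspan_min => // _ [a [b [Aa Ab ->]]].
have -> : Negz n.+1 = -1 + Negz n by lia.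
by apply: hS; exists a, b; split => //; [apply: Sm|apply: IH].
Qed.

(** Brackets of homogeneous elements are homogeneous, so the sums of
    homogeneous elements form a subalgebra containing the generators. *)
Lemma tower_deg_span :
  smallest subalgebra (Am `|` A0 `|` Ap)%classic = setT ->
  forall x, is_sum_of tower_deg x.
Proof.
move=> gen; have sS := is_sum_of_subspace tower_deg_subspace.
suff: (smallest subalgebra (Am `|` A0 `|` Ap) `<=` [set x | is_sum_of tower_deg x])%classic.
  by rewrite gen => h x; apply: h.
apply: smallest_sub; last first.
  move=> x [[] Ax|Ax].
  - by apply: (mem_is_sum_of (i := -1) tower_deg_subspace).
  - by apply: (mem_is_sum_of (i := 0) tower_deg_subspace).
  - by apply: (mem_is_sum_of (i := 1) tower_deg_subspace).
split=> // x y [s [c [Dc ->]]] [t [d [Dd ->]]] /=.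
rewrite (lin_sum (br_linl _)); apply: (subspace_sum sS) => i _.
rewrite (lin_sum (br_linr _)); apply: (subspace_sum sS) => j _.
exact: (mem_is_sum_of tower_deg_subspace (tower_deg_bracket (Dc i) (Dd j))).
Qed.

Lemma fin_dim_tower_deg i :
  fin_dim Am -> fin_dim A0 -> fin_dim Ap -> fin_dim (tower_deg i).
Proof. by move=> fm f0 fp; case: i => [[//|n]|n]; apply: fin_dim_tower. Qed.

End LocalPart.
End Towers.

(** * Homogeneous components *)

Section GradedTheory.
Variable K : fieldType.

Section OneAlgebra.
Variable g : gradedLie K.
Implicit Types (x y t : g) (i j k : int).

Lemma gdeg_subspace i : subspace (@gdeg K g i).
Proof. exact/fin_dim_subspace/gdeg_fin_dim. Qed.

Lemma gdegS i x j : gdeg i x -> i = j -> gdeg j x.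
Proof. by move=> h <-. Qed.

Lemma gdecomposition x : exists c : int -> g, (forall i, gdeg i (c i)) /\
  exists s : seq int, [/\ uniq s, forall i, i \notin s -> c i = 0
                        & x = \sum_(i <- s) c i].
Proof.
have [s [c [us Fc c0 xE]]] := is_sum_ofP gdeg_subspace (gdeg_span x).
by exists c; split => //; exists s.
Qed.

Definition gcomp i x : g := sval (cid (gdecomposition x)) i.

Lemma gcompP i x : gdeg i (gcomp i x).
Proof. by rewrite /gcomp; case: cid => c [Fc _] /=. Qed.

Lemma gcomp_sum x : exists s : seq int,
  [/\ uniq s, forall i, i \notin s -> gcomp i x = 0
    & x = \sum_(i <- s) gcomp i x].
Proof. by rewrite /gcomp; case: cid => c [Fc]. Qed.

Lemma gcomp_unique x (s : seq int) (c : int -> g) :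
  uniq s -> (forall i, gdeg i (c i)) -> (forall i, i \notin s -> c i = 0) ->
  x = \sum_(i <- s) c i -> forall i, gcomp i x = c i.
Proof.
move=> us Fc c0 xE i; have [t [ut d0 xE']] := gcomp_sum x.
pose r := undup (s ++ t).
have ur : uniq r by apply: undup_uniq.
have sr : {subset s <= r} by move=> j js; rewrite mem_undup mem_cat js.
have tr : {subset t <= r} by move=> j jt; rewrite mem_undup mem_cat jt orbT.
have sum0 : \sum_(j <- r) (gcomp j x - c j) = 0.
  by rewrite sumrB (sum_extend_support ut ur) // (sum_extend_support us ur) // -xE -xE' subrr.
apply/eqP; rewrite -subr_eq0; apply/eqP.
have [ir|] := boolP (i \in r); last first.
  by rewrite /r mem_undup mem_cat negb_or => /andP[/c0 -> /d0 ->]; rewrite subrr.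
apply: (gdeg_independent (s := r) (c := fun j => gcomp j x - c j)) => // j.
by apply: subspaceB; [exact: gdeg_subspace|exact: gcompP|].
Qed.

Lemma gcomp_linear i : linear (gcomp i).
Proof.
move=> a x y; have [s [us s0 xE]] := gcomp_sum x; have [t [ut t0 yE]] := gcomp_sum y.
pose r := undup (s ++ t); have ur : uniq r by apply: undup_uniq.
have sr : {subset s <= r} by move=> j js; rewrite mem_undup mem_cat js.
have tr : {subset t <= r} by move=> j jt; rewrite mem_undup mem_cat jt orbT.
apply: (gcomp_unique (s := r) (c := fun i => a *: gcomp i x + gcomp i y)).
- exact: ur.
- move=> j /=; apply: (subspaceD (gdeg_subspace _)); last exact: gcompP.
  by apply: (subspaceZ (gdeg_subspace _)); exact: gcompP.
- move=> j; rewrite /r mem_undup mem_cat negb_or => /andP[/s0 -> /t0 ->].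
  by rewrite scaler0 addr0.
rewrite big_split -scaler_sumr /=.
by rewrite (sum_extend_support us ur) // (sum_extend_support ut ur) // -xE -yE.
Qed.

Lemma gcomp_deg i j x : gdeg j x -> gcomp i x = if i == j then x else 0.
Proof.
move=> xj; apply: (gcomp_unique (s := [:: j]) (c := fun i => if i == j then x else 0)) => //.
- by move=> k; case: eqP => [->|_] //; exact: (subspace0 (gdeg_subspace _)).
- by move=> k; rewrite inE => /negbTE ->.
by rewrite big_seq1 eqxx.
Qed.

Lemma gcomp_id i x : gdeg i x -> gcomp i x = x.
Proof. by move=> /(gcomp_deg i) ->; rewrite eqxx. Qed.

Lemma gcomp_neq i j x : gdeg j x -> i <> j -> gcomp i x = 0.
Proof. by move=> /(gcomp_deg i) -> /eqP/negbTE ->. Qed.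

Lemma gcomp_eq0 x : (forall i, gcomp i x = 0) -> x = 0.
Proof. by move=> h; have [s [_ _ ->]] := gcomp_sum x; apply: big1 => i _. Qed.

Lemma homogeneous_ind (P : set g) : subspace P ->
  (forall i x, gdeg i x -> P x) -> forall x, P x.
Proof.
move=> sP h x; have [s [_ _ ->]] := gcomp_sum x.
by apply: (subspace_sum sP) => i _; apply/h/gcompP.
Qed.

Lemma gcomp_bracket e t i x : gdeg e t -> gcomp i \[t, x\] = \[t, gcomp (i - e) x\].
Proof.
move=> te; move: x.
apply: (@homogeneous_ind [set x | gcomp i \[t, x\] = \[t, gcomp (i - e) x\]]%classic).
  split=> [|a x y /= hx hy]; first by rewrite /= !(br0r, lin0 (gcomp_linear _)).
  by rewrite br_linr !gcomp_linear br_linr hx hy.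
move=> d x xd /=; rewrite (gcomp_deg _ (gdeg_bracket te xd)) (gcomp_deg _ xd).
have -> : (i - e == d) = (i == e + d) by rewrite subr_eq addrC.
by case: ifP => // _; rewrite br0r.
Qed.

Definition local_homogeneous x := exists2 i, (`|i|%N <= 1)%N & gdeg i x.

Lemma local_homogeneousP x : local_homogeneous x <->
  (gdeg (-1) `|` gdeg 0 `|` gdeg 1)%classic x.
Proof.
split=> [[i i1 xi]|[[]|] h]; last 3 first.
- by exists (-1).
- by exists 0.
- by exists 1.
have [|[|]] : i = -1 \/ i = 0 \/ i = 1 by lia.
- by move=> ei; rewrite ei in xi; left; left.
- by move=> ei; rewrite ei in xi; left; right.
- by move=> ei; rewrite ei in xi; right.
Qed.

Lemma generated_subalgebra_ind (P : set g) : subalgebra P ->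
  (forall x, local_homogeneous x -> P x) -> forall x, P x.
Proof.
move=> sP h; suff: ([set: g] `<=` P)%classic by move=> + x; apply.
by rewrite -gdeg_generated; apply: smallest_sub => // x /local_homogeneousP/h.
Qed.

(** The elements under which a subspace is stable form a subalgebra, so a
    subspace stable under the local part is an ideal; if it contains the local
    part it is everything. Iterated brackets of local elements therefore span the
    algebra. *)
Lemma local_word_ind (P : set g) : subspace P ->
  (forall x, local_homogeneous x -> P x) ->
  (forall t x, local_homogeneous t -> P x -> P \[t, x\]) -> forall x, P x.
Proof.
move=> sP hP hs.
pose C (A : set g) := subspace A /\ forall t x, local_homogeneous t -> A x -> A \[t, x\].
pose W := smallest C (@local_homogeneous).
have CW : C W.
  split; last first.
    move=> t x lt Wx M hM; have [[_ adM] _] := hM.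
    exact: (adM _ _ lt (Wx M hM)).
  split=> [M [[[]]] //|a x y Wx Wy M hM]; have [[[_ sM] _] _] := hM.
  exact: (sM _ _ _ (Wx M hM) (Wy M hM)).
suff Wall x : W x.
  by move=> x; apply: (Wall x); split=> //; split=> // t y; apply: hs.
have adW t : forall y, W y -> W \[t, y\].
  move: t; pose N : set g := [set t | forall y, W y -> W \[t, y\]]%classic.
  apply: (@generated_subalgebra_ind N); last by move=> t lt y Wy; apply: CW.2.
  split.
    split=> [y _|a s t Ns Nt y Wy]; first by rewrite br0l; exact: (subspace0 CW.1).
    rewrite br_linl; apply: (subspaceD CW.1); last exact: Nt.
    by apply: (subspaceZ CW.1); apply: Ns.
  move=> s t Ns Nt y Wy.
  have -> : \[\[s, t\], y\] = \[s, \[t, y\]\] - \[t, \[s, y\]\].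
    by rewrite br_leibniz addrK.
  apply: (subspaceB CW.1); first by apply: Ns; apply: Nt.
  by apply: Nt; apply: Ns.
apply: (@generated_subalgebra_ind W); last by move=> y ly M [_]; apply.
by split=> [|s t _ Wt]; [exact: CW.1|exact: adW].
Qed.

Lemma gdeg_bracket0 u x i : gdeg 0 u -> gdeg i x -> gdeg i \[u, x\].
Proof. by move=> u0 xi; apply: gdegS (gdeg_bracket u0 xi) _; rewrite add0r. Qed.

(** The iterated brackets of the generators already exhaust each degree, because
    they span the algebra and components are unique. *)
Lemma gdeg_tower i : @gdeg K g i = tower_deg (gdeg (-1)) (gdeg 0) (gdeg 1) i.
Proof.
have s := gdeg_subspace.
have sub : forall i, (tower_deg (gdeg (-1)) (gdeg 0) (gdeg 1) i `<=` @gdeg K g i)%classic.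
  case=> [[|n]|n] //.
    elim: n => [//|n IH]; apply: lspan_min => // _ [a [b [Aa Ab ->]]].
    by apply: gdegS (gdeg_bracket Aa (IH _ Ab)) _; lia.
  elim: n => [//|n IH]; apply: lspan_min => // _ [a [b [Aa Ab ->]]].
  by apply: gdegS (gdeg_bracket Aa (IH _ Ab)) _; lia.
apply/seteqP; split=> // x xi.
have sd j : subspace (tower_deg (gdeg (-1)) (gdeg 0) (@gdeg K g 1) j).
  exact: tower_deg_subspace.
have : is_sum_of (tower_deg (gdeg (-1)) (gdeg 0) (gdeg 1)) x.
  apply: tower_deg_span => //; last exact: gdeg_generated.
  - by move=> u v; apply: gdeg_bracket.
  - by move=> u v; apply: gdeg_bracket.
  - by move=> u v; apply: gdeg_bracket.
  - by move=> u v; apply: gdeg_bracket.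
move=> /(is_sum_ofP sd)[t [c [ut Dc c0 xE]]].
rewrite -(gcomp_id xi) (gcomp_unique ut _ c0 xE) //.
by move=> j; apply: sub.
Qed.

Lemma gdeg_succ i : 1 <= i ->
  @gdeg K g (1 + i) = lspan (brackets_of (gdeg 1) (gdeg i)).
Proof.
case: i => [[|n]|n] // _; rewrite (gdeg_tower (Posz n.+1)).
by have -> : 1 + Posz n.+1 = Posz n.+2 by []; rewrite gdeg_tower.
Qed.

Lemma gdeg_pred i : i <= -1 ->
  @gdeg K g (-1 + i) = lspan (brackets_of (gdeg (-1)) (gdeg i)).
Proof.
case: i => [n|n] // _; rewrite (gdeg_tower (Negz n)).
have -> : -1 + Negz n = Negz n.+1 by lia.
by rewrite gdeg_tower.
Qed.

End OneAlgebra.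

Section Morphisms.
Variables (g h : gradedLie K) (f : g -> h).
Hypothesis mf : graded_morphism f.

Lemma morphism_gcomp i x : f (gcomp i x) = gcomp i (f x).
Proof.
case: mf => lf df _; have [s [us s0 xE]] := gcomp_sum x.
apply/esym; apply: (gcomp_unique (s := s) (c := fun i => f (gcomp i x))) => //.
- by move=> j; apply/df/gcompP.
- by move=> j /s0 ->; apply: lin0.
by rewrite {1}xE (lin_sum lf).
Qed.

Lemma morphism_gdeg_surj i y :
  set_surj setT setT f -> gdeg i y -> exists2 x, gdeg i x & f x = y.
Proof.
move=> sf yi; have [x _ fx] := sf y I.
by exists (gcomp i x); [apply: gcompP|rewrite morphism_gcomp fx gcomp_id].
Qed.

Lemma morphism_kernel_ideal : graded_ideal [set x | f x = 0]%classic.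
Proof.
case: (mf) => lf df bf; split.
- split=> [|a x y /= fx fy]; first exact: (lin0 lf).
  by rewrite lf fx fy scaler0 addr0.
- by move=> x y /= fy; rewrite bf fy br0r.
move=> x /= fx; have [s [us s0 xE]] := gcomp_sum x.
exists s, (fun i => gcomp i x); split=> // i; split; last exact: gcompP.
by rewrite /= morphism_gcomp fx (lin0 (gcomp_linear i)).
Qed.

Lemma morphism_surj :
  (forall y, local_homogeneous y -> exists x, f x = y) -> set_surj setT setT f.
Proof.
case: (mf) => lf df bf hs y _.
suff: (range f)%classic y by [].
apply: (@generated_subalgebra_ind h (range f)%classic); last first.
  by move=> z /hs[x <-]; exists x.
split; first by apply: image_subspace => //; split.
by move=> _ _ [a _ <-] [b _ <-]; exists \[a, b\].
Qed.

End Morphisms.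

Lemma morphism_comp (g h k : gradedLie K) (f : h -> k) (f' : g -> h) :
  graded_morphism f -> graded_morphism f' -> graded_morphism (f \o f').
Proof.
move=> [lf df bf] [lf' df' bf']; split.
- exact: linear_comp.
- by move=> i x /df' /df.
- by move=> x y /=; rewrite bf' bf.
Qed.

End GradedTheory.

(** * Extension of an invariant form from the local part *)

Section FormExtension.
Variables (K : fieldType) (g : gradedLie K) (beta : g -> g -> K).
Hypotheses (beta_bilin : bilinear_form beta) (beta_sym : symmetric_form beta).
Hypothesis beta_orth : degree_orthogonal beta.
Hypothesis beta_inv : forall i j k x y z,
  (`|i|%N <= 1)%N -> (`|j|%N <= 1)%N -> (`|k|%N <= 1)%N -> i + j + k = 0 ->
  gdeg i x -> gdeg j y -> gdeg k z -> beta \[x, y\] z = beta x \[y, z\].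

Lemma scalar_linear (U : lmodType K) (f : U -> K) : scalar f -> linear (f : U -> K^o).
Proof. by []. Qed.

Lemma beta_linr x : linear (beta x : g -> K^o). Proof. exact: beta_bilin.1. Qed.
Lemma beta_linl y : linear ((fun x => beta x y) : g -> K^o).
Proof. exact: beta_bilin.2. Qed.

(** The letters of a word are paired with a degree in which they lie. *)
Implicit Types w : seq (int * g).

Definition local_word w :=
  forall a, a \in w -> (`|a.1|%N <= 1)%N /\ gdeg a.1 a.2.

Definition lact w (y : g) : g := foldr (fun a y => \[a.2, y\]) y w.
Definition ract (x : g) w : g := foldl (fun x a => \[x, a.2\]) x w.

Lemma lact_cat w1 w2 y : lact (w1 ++ w2) y = lact w1 (lact w2 y).
Proof. exact: foldr_cat. Qed.

Lemma ract_cat x w1 w2 : ract x (w1 ++ w2) = ract (ract x w1) w2.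
Proof. exact: foldl_cat. Qed.

Lemma lactD w y y' : lact w (y + y') = lact w y + lact w y'.
Proof. by elim: w => //= a w ->; rewrite brDr. Qed.

Lemma ract_linear w : linear (fun x => ract x w).
Proof.
by move=> c x y; elim: w x y => //= a w IH x y; rewrite br_linl IH.
Qed.

Lemma local_word_cons a w :
  local_word (a :: w) <-> [/\ (`|a.1|%N <= 1)%N, gdeg a.1 a.2 & local_word w].
Proof.
split=> [h|[a1 a2 h] b].
  have [a1 a2] := h a (mem_head _ _); split=> // b bw; apply: h.
  by rewrite inE bw orbT.
by rewrite inE => /orP[/eqP ->|/h].
Qed.

Lemma local_word_cat w1 w2 :
  local_word (w1 ++ w2) <-> local_word w1 /\ local_word w2.
Proof.
split=> [h|[h1 h2] b]; last by rewrite mem_cat => /orP[/h1|/h2].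
by split=> b bw; apply: h; rewrite mem_cat bw ?orbT.
Qed.

Lemma lact_deg w k q : local_word w -> gdeg k q ->
  gdeg (\sum_(a <- w) a.1 + k) (lact w q).
Proof.
move=> + qk; elim: w => [_|a w IH /local_word_cons[_ da /IH h]] /=.
  by rewrite big_nil add0r.
by rewrite big_cons -addrA; apply: gdeg_bracket.
Qed.

Lemma ract_deg w i p : local_word w -> gdeg i p ->
  gdeg (i + \sum_(a <- w) a.1) (ract p w).
Proof.
elim: w i p => [|a w IH] i p; first by rewrite big_nil addr0.
move=> /local_word_cons[_ da hw] dp /=; rewrite big_cons addrA.
by apply: IH => //; apply: gdeg_bracket.
Qed.

(** When the total degree is not 0 both sides vanish, so local invariance extends
    to z of any degree. *)
Lemma beta_middle d e k z t q :
  (`|e|%N <= 1)%N -> (`|k|%N <= 1)%N -> (absz (e + k)%R <= 1)%N ->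
  gdeg d z -> gdeg e t -> gdeg k q -> beta z \[t, q\] = beta \[z, t\] q.
Proof.
move=> e1 k1 ek1 zd te qk; have [h|h] := eqVneq (d + e + k) 0.
  by rewrite (beta_inv _ _ _ h) //; lia.
rewrite (beta_orth _ zd (gdeg_bracket te qk)); last by move: h => /eqP; lia.
by rewrite (beta_orth _ (gdeg_bracket zd te) qk) //; move: h => /eqP; lia.
Qed.

(** A letter t with t.1 + k local can be absorbed by an element of degree k; a
    letter that cannot has degree k itself. The last absorbable letter is
    followed only by letters of degree k, with which it has a local bracket. *)
Lemma word_split w k : local_word w -> (`|k|%N <= 1)%N ->
  (exists w1 t w2, [/\ w = w1 ++ t :: w2, (absz (t.1 + k)%R <= 1)%N
                     & forall a, a \in w2 -> a.1 = k])
  \/ (w = [::] \/ k <> 0 /\ \sum_(a <- w) a.1 = k *+ size w /\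
      forall a, a \in w -> a.1 = k).
Proof.
move=> + k1; elim: w => [|a w IH]; first by right; left.
move=> /local_word_cons[a1 _ /IH[[w1 [t [w2 [-> tk w2k]]]]|h]].
  by left; exists (a :: w1), t, w2.
have wk : forall b, b \in w -> b.1 = k by case: h => [->|[_ [_]]].
have [ak|ak] := boolP (absz (a.1 + k)%R <= 1)%N; first by left; exists [::], a, w.
have ak' : a.1 = k by lia.
right; right; split; first by lia.
split; last by move=> b; rewrite inE => /orP[/eqP ->|/wk].
rewrite big_cons /= mulrS ak'; congr (_ + _).
by case: h => [->|[_ []]]//; rewrite big_nil.
Qed.

(** Either some letter of w can be moved next to q, where it forms a bracket
    of local degree and the word gets shorter, or all letters of w have the
    degree of q, which is 1 or -1, and both sides vanish for reasons of
    degree. Commuting two letters with a local bracket costs a shorter word. *)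
Lemma word_invariance w i p k q : local_word w ->
  (`|i|%N <= 1)%N -> (`|k|%N <= 1)%N -> gdeg i p -> gdeg k q ->
  beta p (lact w q) = beta (ract p w) q.
Proof.
move: {2}(size w) (leqnn (size w)) => n.
elim: n w k q => [|n IH] w k q; first by rewrite leqn0 => /nilP -> _.
move=> sw lw i1 k1 pi qk.
have [[w1 [t [w2 [wE tk w2k]]]]|[->//|[k0 [sumw _]]]] := word_split lw k1; last first.
  case: w sw lw sumw => [//|b w] sw lw sumw.
  rewrite (beta_orth _ pi (lact_deg lw qk)); last by rewrite sumw /= -mulr_natl; nia.
  by rewrite (beta_orth _ (ract_deg lw pi) qk) // sumw /= -mulr_natl; nia.
(* Move t to the right, past the letters of w2, until it meets q. *)
subst w; elim: w2 w1 sw lw w2k => [|a w2 IHw] w1 sw lw w2k.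
  have [lw1 /local_word_cons[t1 td _]] := (local_word_cat _ _).1 lw.
  rewrite lact_cat ract_cat /=.
  rewrite (IH w1 (t.1 + k)) //; last exact: gdeg_bracket.
    exact: (beta_middle t1 k1 tk (ract_deg lw1 pi) td qk).
  by move: sw; rewrite size_cat /=; lia.
have [lw1 /local_word_cons[t1 td /local_word_cons[a1 ad lw2]]] :=
  (local_word_cat _ _).1 lw.
have ak : a.1 = k by apply: w2k; rewrite mem_head.
have tad := gdeg_bracket td ad.
have lw' : local_word (w1 ++ (t.1 + a.1, \[t.2, a.2\]) :: w2).
  by apply/local_word_cat; split=> //; apply/local_word_cons; split=> //=; rewrite ak.
have e1 := IH _ _ _ _ lw' i1 k1 pi qk.
have := IHw (w1 ++ [:: a]); rewrite -!catA /= => e2.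
move: e1 e2; rewrite !lact_cat !ract_cat /= => e1 e2.
rewrite br_leibniz lactD (linD (beta_linr _)) e1; last first.
  by move: sw; rewrite !size_cat /=; lia.
rewrite e2; last first.
- by move=> b bw; apply: w2k; rewrite inE bw orbT.
- apply/local_word_cat; split=> //; apply/local_word_cons; split=> //.
  by apply/local_word_cons.
- by move: sw; rewrite !size_cat /=.
rewrite -(linD (beta_linl q)) -(linD (ract_linear w2)); congr (beta (ract _ _) _).
by rewrite br_leibniz [X in _ + X + _]br_anti addrNK.
Qed.

(** The functionals that B(x, .) must be equal to, if B is to be invariant and to
    extend beta. *)
Definition represents (x : g) (phi : g -> K) := scalar phi /\
  forall w q, local_word w -> local_homogeneous q ->
    phi (lact w q) = beta (ract x w) q.

Lemma represents_local p : local_homogeneous p -> represents p (beta p).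
Proof.
case=> i i1 pi; split; first exact: beta_bilin.1.
by move=> w q lw [k k1 qk]; apply: word_invariance lw i1 k1 pi qk.
Qed.

(** Prefixing a word by t turns a functional for x into one for [x, t]; this is
    where the invariance of the extension comes from. *)
Lemma represents_br x phi t : local_homogeneous t -> represents x phi ->
  represents \[x, t\] (fun y => phi \[t, y\]).
Proof.
move=> [e e1 te] [sphi hphi]; split=> [a y z|w q lw lq].
  by rewrite br_linr sphi.
rewrite -[\[t, _\]]/(lact ((e, t) :: w) q) hphi //.
by apply/local_word_cons.
Qed.

Lemma represents_lin a x y phi psi : represents x phi -> represents y psi ->
  represents (a *: x + y) (fun z => a * phi z + psi z).
Proof.
move=> [sphi hphi] [spsi hpsi]; split=> [b u v|w q lw lq].
  by rewrite sphi spsi mulrDr mulrDr mulrCA -!addrA; congr (_ + _); rewrite addrCA.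
by rewrite hphi // hpsi // ract_linear (beta_bilin.2 q).
Qed.

(** word_invariance is the case of a local x; brackets propagate it. *)
Lemma represents_exists x : exists phi, represents x phi.
Proof.
move: x; apply: (@local_word_ind _ _ [set x | exists phi, represents x phi]%classic).
- split=> [|a x y [phi hphi] [psi hpsi]]; last first.
    by exists (fun z => a * phi z + psi z); apply: represents_lin.
  exists (beta 0); apply: represents_local; exists 0 => //.
  by apply: subspace0; apply: gdeg_subspace.
- by move=> x lx; exists (beta x); apply: represents_local.
move=> t x lt [phi hphi].
have [e e1 te] := lt.
exists (fun y => phi \[- t, y\]); rewrite br_anti -brNr.
apply: represents_br hphi; exists e => //.
by apply: subspaceN te; apply: gdeg_subspace.
Qed.

Lemma represents_unique x phi psi :
  represents x phi -> represents x psi -> phi = psi.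
Proof.
move=> [sphi hphi] [spsi hpsi]; apply/funext => y.
have agree w q : local_word w -> local_homogeneous q ->
  phi (lact w q) = psi (lact w q) by move=> lw lq; rewrite hphi ?hpsi.
move: y phi psi sphi spsi agree {hphi hpsi}.
apply: (@local_word_ind _ _ [set y | forall phi psi : g -> K,
  scalar phi -> scalar psi ->
  (forall w q, local_word w -> local_homogeneous q ->
     phi (lact w q) = psi (lact w q)) -> phi y = psi y]%classic).
- split=> [phi psi sphi spsi _|a y z hy hz phi psi sphi spsi h].
    by rewrite (lin0 (scalar_linear sphi)) (lin0 (scalar_linear spsi)).
  by rewrite sphi spsi (hy phi psi) // (hz phi psi).
- by move=> y ly phi psi _ _ h; apply: (h [::] y).
move=> t y [e e1 te] hy phi psi sphi spsi h.
apply: (hy (phi \o bracket t) (psi \o bracket t)).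
- by move=> a u v /=; rewrite br_linr sphi.
- by move=> a u v /=; rewrite br_linr spsi.
by move=> w q lw lq; apply: (h ((e, t) :: w)) => //; apply/local_word_cons.
Qed.

Definition extension (x : g) : g -> K := sval (cid (represents_exists x)).

Lemma extensionP x : represents x (extension x).
Proof. exact: svalP (cid (represents_exists x)). Qed.

Lemma extension_local x : local_homogeneous x -> extension x = beta x.
Proof.
move=> lx; apply: represents_unique (extensionP x) _.
exact: represents_local.
Qed.

Lemma extension_bilinear : bilinear_form extension.
Proof.
split=> [x|z a x y]; first exact: (extensionP x).1.
by rewrite (represents_unique (extensionP _)
              (represents_lin a (extensionP x) (extensionP y))).
Qed.

Lemma extension_linl y : linear ((fun x => extension x y) : g -> K^o).
Proof. exact: extension_bilinear.2. Qed.

Lemma extension_linr x : linear (extension x : g -> K^o).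
Proof. exact: extension_bilinear.1. Qed.

Lemma extension_invariant : invariant_form extension.
Proof.
move=> x t z; move: t x z.
apply: (@generated_subalgebra_ind _ _ [set t | forall x z,
    extension \[x, t\] z = extension x \[t, z\]]%classic); last first.
  move=> t lt x z.
  by rewrite (represents_unique (extensionP _) (represents_br lt (extensionP x))).
split=> [|s t hs ht x z].
  split=> [x z|a s t hs ht x z].
    by rewrite br0l br0r (lin0 (extension_linl _)) (lin0 (extension_linr _)).
  by rewrite br_linl br_linr extension_linl extension_linr hs ht.
have -> : \[x, \[s, t\]\] = \[\[x, s\], t\] - \[\[x, t\], s\].
  by rewrite br_leibniz [X in _ + X]br_anti.
have -> : \[\[s, t\], z\] = \[s, \[t, z\]\] - \[t, \[s, z\]\].
  by rewrite br_leibniz addrK.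
by rewrite (linB (extension_linl _)) (linB (extension_linr _)) !(hs, ht).
Qed.

Lemma extension_symmetric : symmetric_form extension.
Proof.
move=> x y; move: y x; apply: (@local_word_ind _ _
  [set y | forall x, extension x y = extension y x]%classic).
- split=> [x|a y z hy hz x].
    by rewrite (lin0 (extension_linl _)) (lin0 (extension_linr _)).
  by rewrite extension_linr extension_linl hy hz.
- move=> y ly x; rewrite (extension_local ly) beta_sym.
  by apply: ((extensionP x).2 [::] y).
move=> t y lt hy x; rewrite -extension_invariant hy [\[x, t\]]br_anti.
by rewrite (linN (extension_linr _)) -extension_invariant -(linN (extension_linl _)) -br_anti.
Qed.

Lemma extension_orthogonal : degree_orthogonal extension.
Proof.
move=> i j x y ij xi yj; rewrite -(gcomp_id xi).
move: x {xi} i j y ij yj; apply: (@local_word_ind _ _ [set x | forall (i j : int) y,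
  i <> - j -> gdeg j y -> extension (gcomp i x) y = 0]%classic).
- split=> [i j y _ _|a x z hx hz i j y ij yj].
    by rewrite (lin0 (gcomp_linear _)) (lin0 (extension_linl _)).
  by rewrite gcomp_linear extension_linl (hx i j) // (hz i j) // scaler0 addr0.
- move=> x [d d1 xd] i j y ij yj; rewrite (gcomp_deg _ xd).
  case: eqP => [e|_]; last by rewrite (lin0 (extension_linl _)).
  rewrite extension_local; last by exists d.
  by apply: beta_orth xd yj; rewrite -e.
move=> t x [e _ te] hx i j y ij yj.
rewrite (gcomp_bracket _ _ te) br_anti (linN (extension_linl _)).
rewrite extension_invariant (hx _ (e + j)) ?oppr0 //; last exact: gdeg_bracket.
by lia.
Qed.

End FormExtension.

(** * Quotients of Lie algebra structures *)

(** Three Lie algebras arise as quotients of types that are not Lie algebras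
    themselves or carry too fine an equality: linear maps up to pointwise
    equality, formal terms up to equality in all models, and a graded Lie algebra
    up to the radical of an invariant form. *)
Record lieSetoid (K : fieldType) := LieSetoid {
  ls_sort :> Type;
  ls_eq : ls_sort -> ls_sort -> Prop;
  ls_zero : ls_sort;
  ls_add : ls_sort -> ls_sort -> ls_sort;
  ls_opp : ls_sort -> ls_sort;
  ls_scale : K -> ls_sort -> ls_sort;
  ls_br : ls_sort -> ls_sort -> ls_sort;
  ls_refl : forall x, ls_eq x x;
  ls_sym : forall x y, ls_eq x y -> ls_eq y x;
  ls_trans : forall x y z, ls_eq x y -> ls_eq y z -> ls_eq x z;
  ls_addP : forall x x' y y', ls_eq x x' -> ls_eq y y' ->
    ls_eq (ls_add x y) (ls_add x' y');
  ls_oppP : forall x x', ls_eq x x' -> ls_eq (ls_opp x) (ls_opp x');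
  ls_scaleP : forall a x x', ls_eq x x' -> ls_eq (ls_scale a x) (ls_scale a x');
  ls_brP : forall x x' y y', ls_eq x x' -> ls_eq y y' ->
    ls_eq (ls_br x y) (ls_br x' y');
  ls_addA : forall x y z, ls_eq (ls_add x (ls_add y z)) (ls_add (ls_add x y) z);
  ls_addC : forall x y, ls_eq (ls_add x y) (ls_add y x);
  ls_add0 : forall x, ls_eq (ls_add ls_zero x) x;
  ls_addN : forall x, ls_eq (ls_add (ls_opp x) x) ls_zero;
  ls_scaleA : forall a b x, ls_eq (ls_scale a (ls_scale b x)) (ls_scale (a * b) x);
  ls_scale1 : forall x, ls_eq (ls_scale 1 x) x;
  ls_scaleDr : forall a x y,
    ls_eq (ls_scale a (ls_add x y)) (ls_add (ls_scale a x) (ls_scale a y));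
  ls_scaleDl : forall x a b,
    ls_eq (ls_scale (a + b) x) (ls_add (ls_scale a x) (ls_scale b x));
  ls_br_linr : forall x a y z, ls_eq (ls_br x (ls_add (ls_scale a y) z))
    (ls_add (ls_scale a (ls_br x y)) (ls_br x z));
  ls_br_linl : forall z a x y, ls_eq (ls_br (ls_add (ls_scale a x) y) z)
    (ls_add (ls_scale a (ls_br x z)) (ls_br y z));
  ls_brxx : forall x, ls_eq (ls_br x x) ls_zero;
  ls_jacobi : forall x y z,
    ls_eq (ls_add (ls_add (ls_br x (ls_br y z)) (ls_br y (ls_br z x)))
             (ls_br z (ls_br x y))) ls_zero
}.

Section LieQuotient.
Variables (K : fieldType) (S : lieSetoid K).

Definition lquot := {c : set S | exists x, c = ls_eq x}.

HB.instance Definition _ := gen_eqMixin lquot.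
HB.instance Definition _ := gen_choiceMixin lquot.

Definition lclass (x : S) : lquot := exist _ (ls_eq x) (ex_intro _ x erefl).
Definition lrepr (c : lquot) : S := sval (cid (svalP c)).

Lemma lclass_eq x y : ls_eq x y -> lclass x = lclass y.
Proof.
move=> xy; apply: eq_exist; apply/funext => z; apply/propext; split.
  by apply: ls_trans; apply: ls_sym.
exact: ls_trans.
Qed.

Lemma lclass_inj x y : lclass x = lclass y -> ls_eq x y.
Proof. by move=> [e]; rewrite e; apply: ls_refl. Qed.

Lemma lreprK c : lclass (lrepr c) = c.
Proof. by case: c => c hc; apply: eq_exist; rewrite /lrepr; case: cid. Qed.

Lemma lrepr_class x : ls_eq (lrepr (lclass x)) x.
Proof. by apply: lclass_inj; rewrite lreprK. Qed.

Definition lq_zero := lclass (ls_zero S).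
Definition lq_add c d := lclass (ls_add (lrepr c) (lrepr d)).
Definition lq_opp c := lclass (ls_opp (lrepr c)).
Definition lq_scale a c := lclass (ls_scale a (lrepr c)).
Definition lq_br c d := lclass (ls_br (lrepr c) (lrepr d)).

Lemma lq_addE x y : lq_add (lclass x) (lclass y) = lclass (ls_add x y).
Proof. by apply/lclass_eq/ls_addP; apply: lrepr_class. Qed.

Lemma lq_oppE x : lq_opp (lclass x) = lclass (ls_opp x).
Proof. by apply/lclass_eq/ls_oppP/lrepr_class. Qed.

Lemma lq_scaleE a x : lq_scale a (lclass x) = lclass (ls_scale a x).
Proof. by apply/lclass_eq/ls_scaleP/lrepr_class. Qed.

Lemma lq_brE x y : lq_br (lclass x) (lclass y) = lclass (ls_br x y).
Proof. by apply/lclass_eq/ls_brP; apply: lrepr_class. Qed.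

Definition lqE := (lq_addE, lq_oppE, lq_scaleE, lq_brE).

Lemma lq_addA : associative lq_add.
Proof.
move=> x y z; rewrite -(lreprK x) -(lreprK y) -(lreprK z) !lqE.
exact/lclass_eq/ls_addA.
Qed.

Lemma lq_addC : commutative lq_add.
Proof.
by move=> x y; rewrite -(lreprK x) -(lreprK y) !lqE; apply/lclass_eq/ls_addC.
Qed.

Lemma lq_add0 : left_id lq_zero lq_add.
Proof. by move=> x; rewrite -(lreprK x) !lqE; apply/lclass_eq/ls_add0. Qed.

Lemma lq_addN : left_inverse lq_zero lq_opp lq_add.
Proof. by move=> x; rewrite -(lreprK x) !lqE; apply/lclass_eq/ls_addN. Qed.

HB.instance Definition _ :=
  GRing.isZmodule.Build lquot lq_addA lq_addC lq_add0 lq_addN.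

Lemma lq_scaleA a b x : lq_scale a (lq_scale b x) = lq_scale (a * b) x.
Proof. by rewrite -(lreprK x) !lqE; apply/lclass_eq/ls_scaleA. Qed.

Lemma lq_scale1 : left_id 1 lq_scale.
Proof. by move=> x; rewrite -(lreprK x) !lqE; apply/lclass_eq/ls_scale1. Qed.

Lemma lq_scaleDr : right_distributive lq_scale +%R.
Proof.
move=> a x y; rewrite -(lreprK x) -(lreprK y) /GRing.add /= !lqE.
exact/lclass_eq/ls_scaleDr.
Qed.

Lemma lq_scaleDl x : {morph lq_scale^~ x : a b / a + b >-> a + b}.
Proof.
move=> a b; rewrite -(lreprK x) [X in _ = X]/GRing.add /= !lqE.
exact/lclass_eq/ls_scaleDl.
Qed.

HB.instance Definition _ := GRing.Zmodule_isLmodule.Build K lquot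
  lq_scaleA lq_scale1 lq_scaleDr lq_scaleDl.

Lemma lclassD x y : lclass x + lclass y = lclass (ls_add x y).
Proof. exact: lq_addE. Qed.

Lemma lclassZ a x : a *: lclass x = lclass (ls_scale a x).
Proof. exact: lq_scaleE. Qed.

Lemma lq_br_linr c : linear (lq_br c).
Proof.
move=> a x y; rewrite -(lreprK x) -(lreprK y) -(lreprK c).
by rewrite lclassZ lclassD !lq_brE lclassZ lclassD; apply/lclass_eq/ls_br_linr.
Qed.

Lemma lq_br_linl c : linear (lq_br^~ c).
Proof.
move=> a x y; rewrite -(lreprK x) -(lreprK y) -(lreprK c).
by rewrite lclassZ lclassD !lq_brE lclassZ lclassD; apply/lclass_eq/ls_br_linl.
Qed.

Lemma lq_brxx c : lq_br c c = 0.
Proof. by rewrite -(lreprK c) !lqE; apply/lclass_eq/ls_brxx. Qed.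

Lemma lq_jacobi x y z :
  lq_br x (lq_br y z) + lq_br y (lq_br z x) + lq_br z (lq_br x y) = 0.
Proof.
rewrite -(lreprK x) -(lreprK y) -(lreprK z) !(lqE, lclassD).
exact/lclass_eq/ls_jacobi.
Qed.

HB.instance Definition _ :=
  Lmodule_isLie.Build K lquot lq_br_linr lq_br_linl lq_brxx lq_jacobi.

(** Hiding the classes behind the projection keeps the choice of representatives
    out of every later computation. *)
Lemma lie_quotient : exists (L : lieType K) (p : S -> L),
  [/\ forall c, exists x, p x = c,
      forall x y, p x = p y <-> ls_eq x y,
      forall x y, p (ls_add x y) = p x + p y,
      forall a x, p (ls_scale a x) = a *: p x
    & forall x y, p (ls_br x y) = \[p x, p y\]].
Proof.
exists lquot, lclass; split.
- by move=> c; exists (lrepr c); apply: lreprK.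
- by move=> x y; split=> [/lclass_inj|/lclass_eq].
- by move=> x y; rewrite lclassD.
- by move=> a x; rewrite lclassZ.
by move=> x y; rewrite -lq_brE.
Qed.

End LieQuotient.

(** * The Lie algebra of endomorphisms of a vector space *)

Section LinearEndomorphisms.
Variables (K : fieldType) (M : lmodType K).

Record lend := LEnd { lend_fun :> M -> M; lend_linear : linear lend_fun }.

Lemma lend_zero : linear (fun _ : M => 0 : M).
Proof. by move=> a u v; rewrite scaler0 addr0. Qed.

Lemma lend_add (f g : lend) : linear (fun v => f v + g v).
Proof. by move=> a u v; rewrite !lend_linear scalerDr addrACA. Qed.

Lemma lend_scale c (f : lend) : linear (fun v => c *: f v).
Proof. by move=> a u v; rewrite lend_linear scalerDr !scalerA mulrC. Qed.

Lemma lend_opp (f : lend) : linear (fun v => - f v).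
Proof. by move=> a u v; rewrite lend_linear opprD scalerN. Qed.

Lemma lend_comm (f g : lend) : linear (fun v => f (g v) - g (f v)).
Proof. by move=> a u v; rewrite !lend_linear opprD scalerBr addrACA. Qed.

Lemma lend_jacobi (f g h : lend) v :
  f (g (h v) - h (g v)) - (g (h (f v)) - h (g (f v)))
  + (g (h (f v) - f (h v)) - (h (f (g v)) - f (h (g v))))
  + (h (f (g v) - g (f v)) - (f (g (h v)) - g (f (h v)))) = 0.
Proof.
have D (k : lend) x y : k (x - y) = k x - k y by apply: (linB (@lend_linear k)).
rewrite !D !opprB !addrA.
rewrite (ACl ((1*12)*(2*7)*(3*10)*(4*5)*(6*11)*(8*9))) /=.
by rewrite !(subrr, addNr, addr0).
Qed.

Definition gl_setoid : lieSetoid K.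
Proof.
apply: (@LieSetoid K lend (fun f g => forall v, f v = g v) (LEnd lend_zero)
  (fun f g => LEnd (lend_add f g)) (fun f => LEnd (lend_opp f))
  (fun c f => LEnd (lend_scale c f)) (fun f g => LEnd (lend_comm f g))) => //=.
- by move=> f g h fg gh v; rewrite fg.
- by move=> f f' g g' ff gg v; rewrite ff gg.
- by move=> f f' ff v; rewrite ff.
- by move=> a f f' ff v; rewrite ff.
- by move=> f f' g g' ff gg v; congr (_ - _); [rewrite ff gg|rewrite gg ff].
- by move=> f g h v; rewrite addrA.
- by move=> f g v; rewrite addrC.
- by move=> f v; rewrite add0r.
- by move=> f v; rewrite addNr.
- by move=> a b f v; rewrite scalerA.
- by move=> f v; rewrite scale1r.
- by move=> a f g v; rewrite scalerDr.
- by move=> f a b v; rewrite scalerDl.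
- by move=> f a g h v; rewrite lend_linear opprD scalerBr addrACA.
- by move=> h a f g v; rewrite lend_linear opprD scalerBr addrACA.
- by move=> f v; rewrite subrr.
- exact: lend_jacobi.
Defined.

End LinearEndomorphisms.

(** * A faithful graded module over a local Lie algebra *)

Section LocalModel.
Variables (K : fieldType) (G : localLie K).

(** A morphism from G to the degrees -1, 0, 1 of a Lie algebra with
    independent homogeneous subspaces, without finiteness or generation:
    graded Lie algebras and endomorphism algebras of graded spaces both
    provide such models. *)
Definition local_model (L : lieType K) (E : int -> set L) (f : local_map G L) :=
  [/\ [/\ forall i, subspace (E i),
          forall i j x y, E i x -> E j y -> E (i + j) \[x, y\]
        & forall (s : seq int) (c : int -> L), uniq s -> (forall i, E i (c i)) ->
            \sum_(i <- s) c i = 0 -> forall i, i \in s -> c i = 0],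
      [/\ linear (fm1 f), linear (f0 f) & linear (fp1 f)],
      [/\ forall y, E (-1) (fm1 f y), forall u, E 0 (f0 f u)
        & forall x, E 1 (fp1 f x)]
    & [/\ forall u v, f0 f \[ u, v \] = \[ f0 f u, f0 f v \],
          forall u y, fm1 f (br0m u y) = \[ f0 f u, fm1 f y \],
          forall u x, fp1 f (br0p u x) = \[ f0 f u, fp1 f x \]
        & forall x y, f0 f (brpm x y) = \[ fp1 f x, fm1 f y \]]].

Lemma local_morphism_model (g : gradedLie K) (f : local_map G g) :
  local_morphism f -> local_model (@gdeg K g) f.
Proof.
move=> [hl hd hb]; split=> //; split; first exact: gdeg_subspace.
  exact: gdeg_bracket.
exact: gdeg_independent.
Qed.

Definition locally_transitive :=
  [/\ forall u : l0 G, (forall x, br0p u x = 0) -> u = 0,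
      forall x : lp1 G, (forall y, brpm x y = 0) -> x = 0
    & forall y : lm1 G, (forall x, brpm x y = 0) -> y = 0].

(** With Y and W the parts of degree -1 and 1, the module is T(Y) (x) W,
    completed: a family of vectors of W indexed by the words in a basis of Y.
    Elements of Y multiply on the left, the part of degree 0 acts by
    derivations extending its action on W, and the part of degree 1 kills W.
    Words are read from the left, so F (j :: w) is the coefficient of e_j in the
    first factor. *)
Local Notation Y := (lm1 G).
Local Notation W := (lp1 G).
Local Notation n := (\dim {:Y}%VS).
Local Notation e j := (vbasis {:Y})`_j.
Local Notation co i y := (coord (vbasis {:Y}) i y).
Local Notation M := (seq 'I_n -> W).

(** Turns sums over the basis of Y back into basis-free expressions. *)
Lemma coord_expand (U : lmodType K) (phi : Y -> U) y : linear phi ->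
  \sum_(j < n) co j y *: phi (e j) = phi y.
Proof.
move=> lphi; rewrite [in RHS](coord_vbasis (memvf y)) (lin_sum lphi).
by apply: eq_bigr => j _; rewrite (linZ lphi).
Qed.

Definition shift (i : 'I_n) (F : M) : M := fun v => F (i :: v).

Lemma shift_linear i : linear (shift i).
Proof. by []. Qed.

Definition op_m (y : Y) (F : M) : M :=
  fun w => if w is i :: w' then co i y *: F w' else 0.

Fixpoint op_0 (u : l0 G) (F : M) (w : seq 'I_n) : W :=
  if w is i :: w' then
    \sum_(j < n) co i (br0m u (e j)) *: F (j :: w') + op_0 u (shift i F) w'
  else br0p u (F [::]).

(** Moving x past the first factor, x (e_j (x) t) = [x, e_j] t + e_j (x) (x t),
    yields the sum over j of the first terms here; op_p adds the second ones. *)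
Definition op_p_first (x : W) (F : M) : M :=
  \sum_(j < n) op_0 (brpm x (e j)) (shift j F).

Fixpoint op_p (x : W) (F : M) (w : seq 'I_n) : W :=
  op_p_first x F w + (if w is i :: w' then op_p x (shift i F) w' else 0).

Lemma sum_apply I (r : seq I) (H : I -> M) w :
  (\sum_(i <- r) H i) w = \sum_(i <- r) H i w.
Proof. by rewrite fct_sumE. Qed.

Lemma comb_apply a (F H : M) w : (a *: F + H) w = a *: F w + H w.
Proof. by []. Qed.

Lemma op_m_linear y : linear (op_m y).
Proof.
move=> a F H; apply/funext => -[|i w]; rewrite [RHS]comb_apply /=.
  by rewrite scaler0 addr0.
by rewrite comb_apply scalerDr !scalerA mulrC.
Qed.

Lemma op_m_linear_l F : linear (op_m^~ F).
Proof.
move=> a y z; apply/funext => -[|i w]; rewrite comb_apply /=.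
  by rewrite scaler0 addr0.
by rewrite linearP scalerDl scalerA.
Qed.

Lemma op_0_linear u : linear (op_0 u).
Proof.
move=> a F H; apply/funext => w; elim: w F H => [|i w IH] F H.
  exact: br0p_linear_r.
rewrite [LHS]/= shift_linear IH.
rewrite [RHS](_ : _ = a *: op_0 u F (i :: w) + op_0 u H (i :: w)) //=.
rewrite scalerDr addrACA scaler_sumr -big_split; congr (_ + _).
by apply: eq_bigr => j _; rewrite scalerDr !scalerA mulrC.
Qed.

Lemma op_0_linear_l F : linear (op_0^~ F).
Proof.
move=> a u v; apply/funext => w; elim: w F => [|i w IH] F.
  exact: br0p_linear_l.
rewrite [LHS]/= IH.
rewrite [RHS](_ : _ = a *: op_0 u F (i :: w) + op_0 v F (i :: w)) //=.
rewrite scalerDr addrACA scaler_sumr -big_split; congr (_ + _).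
by apply: eq_bigr => j _; rewrite br0m_linear_l linearP scalerDl scalerA.
Qed.

Lemma op_p_first_linear x : linear (op_p_first x).
Proof.
move=> a F H; rewrite /op_p_first scaler_sumr -big_split.
by apply: eq_bigr => j _; rewrite shift_linear op_0_linear.
Qed.

Lemma op_p_first_linear_l F : linear (op_p_first^~ F).
Proof.
move=> a x z; rewrite /op_p_first scaler_sumr -big_split.
by apply: eq_bigr => j _; rewrite brpm_linear_l op_0_linear_l.
Qed.

Lemma op_p_cons x F i w :
  op_p x F (i :: w) = op_p_first x F (i :: w) + op_p x (shift i F) w.
Proof. by []. Qed.

Lemma op_p_nil x F : op_p x F [::] = op_p_first x F [::].
Proof. exact: addr0. Qed.

Lemma op_p_linear x : linear (op_p x).
Proof.
move=> a F H; apply/funext => w; elim: w F H => [|i w IH] F H.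
  rewrite [RHS](_ : _ = a *: op_p x F [::] + op_p x H [::]) //.
  by rewrite !op_p_nil op_p_first_linear.
rewrite [RHS](_ : _ = a *: op_p x F (i :: w) + op_p x H (i :: w)) //.
by rewrite !op_p_cons shift_linear IH op_p_first_linear scalerDr addrACA.
Qed.

Lemma op_p_linear_l F : linear (op_p^~ F).
Proof.
move=> a x z; apply/funext => w; elim: w F => [|i w IH] F.
  rewrite [RHS](_ : _ = a *: op_p x F [::] + op_p z F [::]) //.
  by rewrite !op_p_nil op_p_first_linear_l.
rewrite [RHS](_ : _ = a *: op_p x F (i :: w) + op_p z F (i :: w)) //.
by rewrite !op_p_cons IH op_p_first_linear_l scalerDr addrACA.
Qed.

Lemma op_0_cons u F i w : op_0 u F (i :: w) =
  \sum_(j < n) co i (br0m u (e j)) *: shift j F w + op_0 u (shift i F) w.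
Proof. by []. Qed.

Lemma shift_op_0 u F i : shift i (op_0 u F) =
  \sum_(j < n) co i (br0m u (e j)) *: shift j F + op_0 u (shift i F).
Proof. by apply/funext => w; rewrite /shift /= [in RHS]/GRing.add /= sum_apply. Qed.

(** The terms with one derivative on the first letter and one on the rest are
    symmetric in u and v, and cancel in the commutator. *)
Lemma op_0_op_0_cons u v F i w : op_0 u (op_0 v F) (i :: w) =
  \sum_(j < n) co i (br0m u (br0m v (e j))) *: shift j F w
  + \sum_(j < n) co i (br0m u (e j)) *: op_0 v (shift j F) w
  + (\sum_(j < n) co i (br0m v (e j)) *: op_0 u (shift j F) w
     + op_0 u (op_0 v (shift i F)) w).
Proof.
rewrite op_0_cons shift_op_0 (linD (op_0_linear u)) (lin_sum (op_0_linear u)).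
rewrite [X in _ + X](_ : _ = (\sum_(j < n) co i (br0m v (e j)) *: op_0 u (shift j F)) w
  + op_0 u (op_0 v (shift i F)) w); last first.
  rewrite -[RHS]/((_ + _) w).
  by congr ((_ + _) w); apply: eq_bigr => j _; rewrite (linZ (op_0_linear u)).
rewrite sum_apply; congr (_ + _).
transitivity (\sum_(j < n) (\sum_(k < n) (co i (br0m u (e j)) * co j (br0m v (e k))) *: shift k F w
   + co i (br0m u (e j)) *: op_0 v (shift j F) w)).
  apply: eq_bigr => j _.
  rewrite shift_op_0 [X in _ *: X]/GRing.add /= scalerDr sum_apply scaler_sumr.
  by congr (_ + _); apply: eq_bigr => k _; rewrite scalerA.
rewrite big_split /=; congr (_ + _); rewrite exchange_big; apply: eq_bigr => k _ /=.
rewrite -scaler_suml; congr (_ *: _).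
have lin : linear (fun y => co i (br0m u y) : K^o).
  by move=> a y z; rewrite br0m_linear_r linearP.
rewrite -[RHS](coord_expand _ lin).
by apply: eq_bigr => j _; rewrite mulrC.
Qed.

Lemma op_0_op_0 u v F : op_0 \[u, v\] F = op_0 u (op_0 v F) - op_0 v (op_0 u F).
Proof.
apply/funext => w; rewrite [RHS](_ : _ = op_0 u (op_0 v F) w - op_0 v (op_0 u F) w) //.
elim: w F => [|i w IH] F; first exact: jacobi00p.
rewrite op_0_cons IH !op_0_op_0_cons.
under eq_bigr => j _ do rewrite jacobi00m linearB scalerBl.
rewrite sumrB; set A := \sum_(j < n) _; set B := \sum_(j < n) _; set C := \sum_(j < n) _.
set D := \sum_(j < n) _; set p := op_0 _ _ _; set q := op_0 _ _ _.
rewrite !opprD !addrA.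
by rewrite [RHS](ACl ((1*5)*4*8*((2*7)*(3*6)))) /= !subrr !addr0.
Qed.

Lemma op_0_op_m u y F :
  op_m (br0m u y) F = op_0 u (op_m y F) - op_m y (op_0 u F).
Proof.
apply/funext => w; rewrite [RHS](_ : _ = op_0 u (op_m y F) w - op_m y (op_0 u F) w) //.
case: w => [|i w] /=; first by rewrite (lin0 (br0p_linear_r u)) subrr.
rewrite [op_0 u _ w](_ : _ = co i y *: op_0 u F w); last first.
  by rewrite -[RHS]/((co i y *: op_0 u F) w) -(linZ (op_0_linear u)).
rewrite addrK; have lin : linear (fun y => co i (br0m u y) : K^o).
  by move=> a z t; rewrite br0m_linear_r linearP.
rewrite -(coord_expand _ lin) scaler_suml.
by apply: eq_bigr => j _; rewrite scalerA mulrC.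
Qed.

(** On y (x) F the operator of x splits into [x, y] F and y (x) (x F). *)
Lemma op_p_op_m x y F :
  op_0 (brpm x y) F = op_p x (op_m y F) - op_m y (op_p x F).
Proof.
have first : op_p_first x (op_m y F) = op_0 (brpm x y) F.
  have lin : linear (fun y => op_0 (brpm x y) F).
    by move=> a z t; rewrite brpm_linear_r op_0_linear_l.
  rewrite -(coord_expand _ lin); apply: eq_bigr => j _.
  by rewrite -(linZ (op_0_linear _)).
apply/funext => w; rewrite [RHS](_ : _ = op_p x (op_m y F) w - op_m y (op_p x F) w) //.
case: w => [|i w]; first by rewrite op_p_nil first subr0.
rewrite op_p_cons first -addrA [X in _ + X](_ : _ = 0) ?addr0 //.
rewrite [shift i _](_ : _ = co i y *: F) // (linZ (op_p_linear x)).
exact: subrr.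
Qed.

Lemma op_0_op_p_first u x F : op_p_first (br0p u x) F =
  op_0 u (op_p_first x F) - op_p_first x (op_0 u F).
Proof.
rewrite /op_p_first (lin_sum (op_0_linear u)).
have -> : \sum_(j < n) op_0 (brpm x (e j)) (shift j (op_0 u F)) =
    \sum_(j < n) op_0 (brpm x (br0m u (e j))) (shift j F)
    + \sum_(j < n) op_0 (brpm x (e j)) (op_0 u (shift j F)).
  under eq_bigr => j _ do rewrite shift_op_0 (linD (op_0_linear _)) (lin_sum (op_0_linear _)).
  rewrite big_split /=; congr (_ + _); rewrite exchange_big /=; apply: eq_bigr => k _.
  have lin : linear (fun y => op_0 (brpm x y) (shift k F)).
    by move=> a z t; rewrite brpm_linear_r op_0_linear_l.
  rewrite -(coord_expand _ lin); apply: eq_bigr => j _.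
  by rewrite (linZ (op_0_linear _)).
rewrite opprD addrCA -sumrB addrC -sumrB; apply: eq_bigr => j _.
rewrite -op_0_op_0 jacobi0pm.
by rewrite (linD (op_0_linear_l _)) addrK.
Qed.

Lemma op_0_op_p u x F : op_p (br0p u x) F = op_0 u (op_p x F) - op_p x (op_0 u F).
Proof.
apply/funext => w; rewrite [RHS](_ : _ = op_0 u (op_p x F) w - op_p x (op_0 u F) w) //.
elim: w F => [|i w IH] F.
  rewrite !op_p_nil op_0_op_p_first.
  rewrite [LHS](_ : _ = br0p u (op_p_first x F [::]) - op_p_first x (op_0 u F) [::]) //.
  by rewrite -(op_p_nil x F).
rewrite op_p_cons IH op_0_op_p_first.
rewrite [(_ - _) (i :: w)](_ : _ = op_0 u (op_p_first x F) (i :: w)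
   - op_p_first x (op_0 u F) (i :: w)) //.
rewrite [op_p x _ (i :: w)]op_p_cons shift_op_0 (linD (op_p_linear x)).
rewrite (lin_sum (op_p_linear x)).
rewrite [X in _ = _ - (_ + X)](_ : _ = (\sum_(j < n) co i (br0m u (e j)) *: op_p x (shift j F) w)
  + op_p x (op_0 u (shift i F)) w); last first.
  rewrite [LHS]/GRing.add /= sum_apply; congr (_ + _).
  by apply: eq_bigr => j _; rewrite (linZ (op_p_linear x)).
have -> : op_0 u (op_p x F) (i :: w) = op_0 u (op_p_first x F) (i :: w)
   + (\sum_(j < n) co i (br0m u (e j)) *: op_p x (shift j F) w + op_0 u (op_p x (shift i F)) w).
  rewrite !op_0_cons.
  have -> : shift i (op_p x F) = shift i (op_p_first x F) + op_p x (shift i F) by [].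
  rewrite (linD (op_0_linear u)) addrACA -big_split; congr (_ + _).
  by apply: eq_bigr => j _; rewrite /= -scalerDr.
by rewrite !opprD !addrA [RHS](ACl (1*4*3*6*(2*5))) /= subrr addr0.
Qed.

(** The operator f shifts degrees by i: f F at w depends only on the values
    of F at words of length size w + i. *)
Definition op_deg (i : int) (f : M -> M) : Prop :=
  forall F w, (forall v, Posz (size v) = Posz (size w) + i -> F v = 0) -> f F w = 0.

Lemma op_m_deg y : op_deg (-1) (op_m y).
Proof.
move=> F [|i w] h //=; rewrite h ?scaler0 //=; lia.
Qed.

Lemma op_0_deg u : op_deg 0 (op_0 u).
Proof.
move=> F w; elim: w F => [|i w IH] F h /=.
  by rewrite h // (lin0 (br0p_linear_r u)).
rewrite big1 ?add0r => [|j _]; last by rewrite h ?scaler0 //=; lia.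
by apply: IH => v hv; apply: h => /=; lia.
Qed.

Lemma op_p_deg x : op_deg 1 (op_p x).
Proof.
have first F w : (forall v, Posz (size v) = Posz (size w) + 1 -> F v = 0) ->
    op_p_first x F w = 0.
  move=> h; rewrite /op_p_first sum_apply big1 // => j _.
  by apply: op_0_deg => v hv; apply: h => /=; lia.
move=> F w; elim: w F => [|i w IH] F h.
  by rewrite op_p_nil first.
by rewrite op_p_cons first // IH ?addr0 // => v hv; apply: h => /=; lia.
Qed.

End LocalModel.

Section FaithfulModel.
Variables (K : fieldType) (G : localLie K).
Hypothesis trG : locally_transitive G.

Local Notation n := (\dim {:lm1 G}%VS).
Local Notation M := (seq 'I_n -> lp1 G).

Lemma op_deg_comb i a (f h : M -> M) :
  op_deg i f -> op_deg i h -> op_deg i (fun F => a *: f F + h F).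
Proof.
by move=> df dh F w hF; rewrite comb_apply df // dh // scaler0 addr0.
Qed.

Lemma op_deg_comp i j (f h : M -> M) :
  op_deg i f -> op_deg j h -> op_deg (i + j) (f \o h).
Proof.
move=> df dh F w hF; apply: df => v sv; apply: dh => t st; apply: hF.
by rewrite st sv addrA.
Qed.

(** The module is a product over all words, so a sum of operators of distinct
    degrees is separated by feeding it the truncation F' of F to the single
    length that the operator of degree i can see at w. *)
Lemma op_deg_independent (s : seq int) (f : int -> lend M) :
  uniq s -> (forall i, op_deg i (f i)) ->
  (forall F, \sum_(i <- s) f i F = 0) -> forall i, i \in s -> forall F, f i F = 0.
Proof.
move=> us df sf i si F; apply/funext => w; rewrite -[RHS]/(0 : lp1 G).
pose F' : M := fun v => if Posz (size v) == Posz (size w) + i then F v else 0.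
have F'F : f i (F - F') w = 0.
  apply: df => v sv; rewrite -[LHS]/(F v - F' v) /F' sv eqxx; exact: subrr.
have fF' : f i F' w = 0.
  have := congr1 (@^~ w) (sf F'); rewrite sum_apply (bigD1_seq i) //=.
  rewrite big1 ?addr0 // => j /eqP ji; apply: df => v sv; rewrite /F'.
  by case: eqP => // sv'; exfalso; apply: ji; lia.
have -> : f i F = f i (F - F') + f i F' by rewrite -(linD (@lend_linear _ _ (f i))) subrK.
by rewrite -[LHS]/(f i (F - F') w + f i F' w) F'F fF' addr0.
Qed.

(** Faithfulness of u in degree 0 is visible on W, that of y on constants
    y (x) w, and that of x on e_j (x) w, which it maps to [x, e_j] w. *)
Lemma faithful_local_model : exists (L : lieType K) (E : int -> set L)
    (f : local_map G L),
  local_model E f /\ [/\ injective (fm1 f), injective (f0 f) & injective (fp1 f)].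
Proof.
pose S := gl_setoid (M : lmodType K).
have [L [p [psurj peq pD pZ pB]]] := lie_quotient S.
pose z : lend M := ls_zero S.
have p0 : p z = 0.
  by rewrite -[RHS](scale0r (p z)) -pZ; apply/peq => F /=; rewrite scale0r.
pose fm y := p (LEnd (op_m_linear y)); pose f0 u := p (LEnd (op_0_linear u)).
pose fp x := p (LEnd (op_p_linear x)).
have pcomb a (f h : lend M) : a *: p f + p h = p (@ls_add K S (@ls_scale K S a f) h).
  by rewrite pD pZ.
pose E i : set L := [set x | exists2 f, op_deg i (lend_fun f) & p f = x]%classic.
exists L, E, (LocalMap fm f0 fp); split; last first.
  case: trG => tr0 trp trm; split=> /=.
  - move=> y y' /peq/= e; apply/eqP; rewrite -subr_eq0; apply/eqP; apply: trm => x.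
    have [->|/eqP x0] := pselect (x = 0); first exact: (lin0 (brpm_linear_l _)).
    rewrite [X in brpm x X](_ : _ = 0) ?(lin0 (brpm_linear_r _)) //.
    rewrite (coord_vbasis (memvf (y - y'))); apply: big1 => i _.
    have := congr1 (@^~ [:: i]) (e (fun=> x)) => /= /eqP.
    by rewrite -subr_eq0 -scalerBl -linearB scaler_eq0 (negbTE x0) orbF => /eqP ->; rewrite scale0r.
  - move=> u u' /peq/= e; apply/eqP; rewrite -subr_eq0; apply/eqP; apply: tr0 => x.
    have := congr1 (@^~ [::]) (e (fun=> x)) => /= ex.
    by rewrite (linB (br0p_linear_l _)) ex subrr.
  move=> x x' /peq/= e; apply/eqP; rewrite -subr_eq0; apply/eqP; apply: trp => y.
  have {}e F : op_p (x - x') F = 0.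
    by rewrite (linB (op_p_linear_l F)) e subrr.
  rewrite (coord_vbasis (memvf y)) (lin_sum (brpm_linear_r _)); apply: big1 => i _.
  rewrite (linZ (brpm_linear_r (x - x'))) (tr0 (brpm _ _)) ?scaler0 // => w.
  (* Evaluate at the element e_i (x) w. *)
  have := congr1 (@^~ [::]) (e (fun v => if v == [:: i] then w else 0)).
  rewrite op_p_nil /op_p_first sum_apply (bigD1 i) //= /shift eqxx.
  rewrite big1 ?addr0 // => j ji; rewrite eqseq_cons (negbTE ji) /=.
  exact: (lin0 (br0p_linear_r _)).
split.
- split.
  + move=> i; split=> [|a _ _ [f df <-] [h dh <-]].
      by exists z => // F w _.
    by rewrite pcomb; eexists; [|reflexivity]; apply: op_deg_comb.
  + move=> i j _ _ [f df <-] [h dh <-]; rewrite -pB; eexists; [|reflexivity].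
    move=> F w hF; rewrite -[LHS]/((f \o h) F w - (h \o f) F w).
    rewrite (op_deg_comp df dh) // (op_deg_comp dh df) ?subrr //.
    by move=> v; rewrite (addrC j); apply: hF.
  move=> s c us Ec sc i si.
  have /choice[f fP] : forall i, exists f : lend M, op_deg i f /\ p f = c i.
    by move=> j; have [f df pf] := Ec j; exists f.
  rewrite -(fP i).2 -p0; apply/peq => F.
  apply: (op_deg_independent us (fun i => (fP i).1)) => // {}F.
  have [h [ph hE]] : exists h : lend M, p h = \sum_(i <- s) c i /\
      forall F, h F = \sum_(i <- s) f i F.
    elim: (s) => [|j t [h [ph hE]]].
      by exists z; split=> [|H]; rewrite big_nil.
    exists (@ls_add K S (f j) h); split=> [|H].
      by rewrite pD ph big_cons (fP j).2.
    by rewrite big_cons -hE.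
  by rewrite -hE; move: ph; rewrite sc -p0 => /peq ->.
- split=> a u v /=; rewrite pcomb; apply/peq => F /=.
  + by rewrite op_m_linear_l.
  + by rewrite op_0_linear_l.
  + by rewrite op_p_linear_l.
- split=> u /=; eexists; try reflexivity.
  + exact: op_m_deg.
  + exact: op_0_deg.
  + exact: op_p_deg.
split=> u v /=; rewrite -pB; apply/peq => F /=.
- exact: op_0_op_0.
- exact: op_0_op_m.
- exact: op_0_op_p.
- exact: op_p_op_m.
Qed.

End FaithfulModel.

(** * The maximal graded Lie algebra of a local Lie algebra *)

Section MaximalAlgebra.
Variables (K : fieldType) (G : localLie K).

Inductive lie_term :=
  | Tm of lm1 G | T0 of l0 G | Tp of lp1 G
  | TAdd of lie_term & lie_term | TScale of K & lie_term
  | TBr of lie_term & lie_term.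

Fixpoint teval (L : lieType K) (f : local_map G L) (t : lie_term) : L :=
  match t with
  | Tm y => fm1 f y
  | T0 u => f0 f u
  | Tp x => fp1 f x
  | TAdd t1 t2 => teval f t1 + teval f t2
  | TScale a t1 => a *: teval f t1
  | TBr t1 t2 => \[teval f t1, teval f t2\]
  end.

(** Two terms are identified when no model separates them: the axioms, the
    universal property and the independence of the homogeneous subspaces are
    then inherited from the models. *)
Definition teq (t1 t2 : lie_term) : Prop :=
  forall (L : lieType K) (E : int -> set L) (f : local_map G L),
    local_model E f -> teval f t1 = teval f t2.

(** The zero of degree 0 and scaling by -1 stand for zero and opposite. *)
Definition term_setoid : lieSetoid K.
Proof.
apply: (@LieSetoid K lie_term teq (T0 0) TAdd (TScale (-1)) TScale TBr).
- by [].
- by move=> x y h L E f m; rewrite (h _ _ _ m).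
- by move=> x y z h1 h2 L E f m; rewrite (h1 _ _ _ m) (h2 _ _ _ m).
- by move=> x x' y y' h1 h2 L E f m /=; rewrite (h1 _ _ _ m) (h2 _ _ _ m).
- by move=> x x' h1 L E f m /=; rewrite (h1 _ _ _ m).
- by move=> a x x' h1 L E f m /=; rewrite (h1 _ _ _ m).
- by move=> x x' y y' h1 h2 L E f m /=; rewrite (h1 _ _ _ m) (h2 _ _ _ m).
- by move=> x y z L E f m /=; rewrite addrA.
- by move=> x y L E f m /=; rewrite addrC.
- by move=> x L E f [_ [_ l _] _ _] /=; rewrite (lin0 l) add0r.
- by move=> x L E f [_ [_ l _] _ _] /=; rewrite (lin0 l) scaleN1r addNr.
- by move=> a b x L E f m /=; rewrite scalerA.
- by move=> x L E f m /=; rewrite scale1r.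
- by move=> a x y L E f m /=; rewrite scalerDr.
- by move=> x a b L E f m /=; rewrite scalerDl.
- by move=> x a y z L E f m /=; rewrite br_linr.
- by move=> x a y z L E f m /=; rewrite br_linl.
- by move=> x L E f [_ [_ l _] _ _] /=; rewrite (lin0 l) bracketxx.
- by move=> x y z L E f [_ [_ l _] _ _] /=; rewrite (lin0 l) bracket_jacobi.
Defined.

Lemma subspace_setT (L : lmodType K) : subspace [set: L].
Proof. by []. Qed.

(** Every graded Lie algebra with a morphism from G is a model, so evaluation
    gives the universal property. The tower of iterated brackets is a grading:
    a vanishing sum of homogeneous classes vanishes termwise in each model. Its
    local part is the image of G, and a faithful model shows that G embeds. *)
Lemma gmax_exists : locally_transitive G ->
  exists (g : gradedLie K) (iota : local_map G g), is_gmax iota.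
Proof.
move=> trG; have [L [p [psurj peq pD pZ pB]]] := lie_quotient term_setoid.
have pT t1 t2 : teq t1 t2 -> p t1 = p t2 by move=> /peq.
have lm : linear (p \o Tm).
  move=> a y z /=; rewrite -pZ -pD; apply: pT => L' E f [_ [l _ _] _ _] /=.
  exact: l.
have l0 : linear (p \o T0).
  move=> a y z /=; rewrite -pZ -pD; apply: pT => L' E f [_ [_ l _] _ _] /=.
  exact: l.
have lp : linear (p \o Tp).
  move=> a y z /=; rewrite -pZ -pD; apply: pT => L' E f [_ [_ _ l] _ _] /=.
  exact: l.
have [B00 B0m B0p Bpm] : [/\ forall u v, p (T0 \[u, v\]) = \[p (T0 u), p (T0 v)\],
   forall u y, p (Tm (br0m u y)) = \[p (T0 u), p (Tm y)\],
   forall u x, p (Tp (br0p u x)) = \[p (T0 u), p (Tp x)\]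
   & forall x y, p (T0 (brpm x y)) = \[p (Tp x), p (Tm y)\]].
  by split=> u v; rewrite -pB; apply: pT => L' E f [_ _ _ []] /=.
pose Am : set L := range (p \o Tm); pose A0 : set L := range (p \o T0).
pose Ap : set L := range (p \o Tp); pose D := tower_deg Am A0 Ap.
have sAm : subspace Am by apply: image_subspace lm (@subspace_setT _).
have sA0 : subspace A0 by apply: image_subspace l0 (@subspace_setT _).
have sAp : subspace Ap by apply: image_subspace lp (@subspace_setT _).
have h00 u v : A0 u -> A0 v -> A0 \[u, v\].
  by move=> [a _ <-] [b _ <-]; exists \[a, b\] => //=; rewrite B00.
have h0m u v : A0 u -> Am v -> Am \[u, v\].
  by move=> [a _ <-] [b _ <-]; exists (br0m a b) => //=; rewrite B0m.
have h0p u v : A0 u -> Ap v -> Ap \[u, v\].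
  by move=> [a _ <-] [b _ <-]; exists (br0p a b) => //=; rewrite B0p.
have hpm u v : Ap u -> Am v -> A0 \[u, v\].
  by move=> [a _ <-] [b _ <-]; exists (brpm a b) => //=; rewrite Bpm.
have gen : smallest subalgebra (Am `|` A0 `|` Ap)%classic = setT.
  apply/seteqP; split=> // x _ S [[[S0 Slin] Sbr] SA].
  have [t <-] := psurj x; elim: t => [y|u|y|s hs t ht|a t ht|s hs t ht].
  - by apply: SA; left; left; exists y.
  - by apply: SA; left; right; exists u.
  - by apply: SA; right; exists y.
  - by rewrite pD -[p s]scale1r; apply: Slin.
  - by rewrite pZ -[_ *: _]addr0; apply: Slin.
  - by rewrite pB; apply: Sbr.
have sD i : subspace (D i) by apply: tower_deg_subspace.
have evalP (L' : lieType K) (E : int -> set L') (f : local_map G L') :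
    local_model E f -> exists phi : L -> L',
    [/\ linear phi, forall x y, phi \[x, y\] = \[phi x, phi y\],
       forall t, phi (p t) = teval f t & forall i x, D i x -> E i (phi x)].
  move=> mf; have /choice[r rP] := psurj.
  pose phi x := teval f (r x).
  have phiE t : phi (p t) = teval f t.
    by have /peq := rP (p t); apply; exact: mf.
  have lphi : linear phi.
    move=> a x y; have [t <-] := psurj x; have [s <-] := psurj y.
    by rewrite -pZ -pD !phiE.
  have bphi x y : phi \[x, y\] = \[phi x, phi y\].
    by have [t <-] := psurj x; have [s <-] := psurj y; rewrite -pB !phiE.
  exists phi; split=> //.
  case: mf => [[sE bE _] _ [dm d0 dp] _].
  have Ep x : Ap x -> E 1 (phi x) by move=> [a _ <-]; rewrite /= phiE /=.
  have Em x : Am x -> E (-1) (phi x) by move=> [a _ <-]; rewrite /= phiE /=.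
  have step e i (A B : set L) : (forall x, A x -> E e (phi x)) ->
      (forall x, B x -> E i (phi x)) ->
      forall x, lspan (brackets_of A B) x -> E (e + i) (phi x).
    move=> hA hB; suff : (lspan (brackets_of A B) `<=` phi @^-1` E (e + i))%classic by [].
    apply: lspan_min; first exact: preimage_subspace.
    by move=> _ [a [b [Aa Bb ->]]] /=; rewrite bphi; apply: bE; [apply: hA|apply: hB].
  case=> [[|m]|m] x.
  - by move=> [a _ <-]; rewrite /= phiE /=.
  - elim: m x => [|m IH] x; first exact: Ep.
    have -> : Posz m.+2 = 1 + Posz m.+1 by lia.
    exact: step.
  elim: m x => [|m IH] x; first exact: Em.
  have -> : Negz m.+1 = -1 + Negz m by lia.
  exact: step.
have indep (s : seq int) (c : int -> L) : uniq s -> (forall i, D i (c i)) ->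
    \sum_(i <- s) c i = 0 -> forall i, i \in s -> c i = 0.
  move=> us Dc sc i si; have [t ct] := psurj (c i).
  rewrite -ct -(lin0 l0) /=; apply: pT => L' E f mf.
  have [phi [lphi _ phiE dphi]] := evalP _ _ _ mf.
  have [[_ _ ind] [_ lf0 _] _ _] := mf.
  rewrite /= (lin0 lf0) -phiE ct.
  apply: (ind s (phi \o c)) => // [j|]; first exact: dphi.
  by rewrite -(lin_sum lphi) sc (lin0 lphi).
pose g := @GradedLie K L D
  (fun i => fin_dim_tower_deg i (fin_dim_range lm) (fin_dim_range l0) (fin_dim_range lp))
  (tower_deg_span sAm sA0 sAp h00 h0m h0p hpm gen) indep
  (tower_deg_bracket sAm sA0 sAp h00 h0m h0p hpm) gen.
exists g, (LocalMap (p \o Tm) (p \o T0) (p \o Tp)); split.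
  have [L' [E [f [mf [im i0 ip]]]]] := faithful_local_model trG.
  split.
  - by split; split=> //= x; exists x.
  - split; [by move=> x _; exists x| |by move=> _ [x _ <-]; exists x].
    by move=> x y _ _ /peq/(_ _ _ _ mf)/im.
  - split; [by move=> x _; exists x| |by move=> _ [x _ <-]; exists x].
    by move=> x y _ _ /peq/(_ _ _ _ mf)/i0.
  - split; [by move=> x _; exists x| |by move=> _ [x _ <-]; exists x].
    by move=> x y _ _ /peq/(_ _ _ _ mf)/ip.
move=> h f lf; have [phi [lphi bphi phiE dphi]] := evalP _ _ _ (local_morphism_model lf).
exists phi; split.
  split; first by split.
  by case: (f) phiE => a b c phiE; congr LocalMap; apply/funext => x; rewrite /= phiE.
move=> psi [[lpsi dpsi bpsi] psiE]; apply/funext => x; have [t <-] := psurj x.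
rewrite phiE -psiE; elim: t => //= [s -> t ->|a t ->|s -> t ->].
- by rewrite pD (linD lpsi).
- by rewrite pZ (linZ lpsi).
by rewrite pB bpsi.
Qed.

End MaximalAlgebra.

(** * The local Lie algebra of a fundamental triplet *)

Section TripletLocal.
Variables (K : fieldType) (T : triplet K).
Local Notation V := (tV T).
Local Notation g0 := (tg0 T).

Lemma dual_separates (U : vectType K) (x : U) :
  (forall phi : dual U, phi x = 0) -> x = 0.
Proof.
move=> h; rewrite (coord_vbasis (memvf x)); apply: big1 => i _.
have := h (linfun (coord (vbasis {:U}) i : U -> K^o)).
by rewrite lfunE /= => ->; rewrite scale0r.
Qed.

Lemma contragredientE (u : g0) (Y : dual V) (X : V) :
  contragredient u Y X = - Y (trho u X).
Proof. by rewrite /contragredient opp_lfunE comp_lfunE. Qed.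

(** Faithfulness is the condition in degree 0. If [X, Y] = 0 for all Y, then X is
    killed by every rho*(u) Y, hence by every functional, as these span; dually
    in degree -1. *)
Lemma admissible_locally_transitive : admissible T -> locally_transitive (Gamma T).
Proof.
move=> [inj gV gY]; split=> /=.
- move=> u h; apply: inj; apply/lfunP => X.
  by rewrite h (lin0 (@trho_linear _ T)) zero_lfunE.
- move=> X h; apply: dual_separates => phi.
  have : [set: dual V]%classic phi by [].
  rewrite -gY; move: phi.
  suff: (smallest subspace [set w : dual V | exists u Y, w = contragredient u Y]
    `<=` [set w : dual V | w X = 0])%classic by [].
  apply: smallest_sub => [|_ [u [Y ->]] /=].
    split=> [|a y z /= hy hz]; first by rewrite /= zero_lfunE.
    by rewrite add_lfunE scale_lfunE hy hz scaler0 addr0.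
  rewrite contragredientE -momentE h; have [_ l] := tB0_bilinear T.
  by rewrite (lin0 (scalar_linear (l u))) oppr0.
move=> Y h; apply/lfunP => X; rewrite zero_lfunE.
have : [set: V]%classic X by [].
rewrite -gV; move: X.
suff: (smallest subspace [set v : V | exists u X, v = trho u X]
  `<=` [set X : V | Y X = 0])%classic by [].
apply: smallest_sub => [|_ [u [X ->]] /=].
  split=> [|a y z /= hy hz]; first by rewrite /= linear0.
  by rewrite linearP /= hy hz scaler0 addr0.
rewrite -momentE h; have [_ l] := tB0_bilinear T.
by rewrite (lin0 (scalar_linear (l u))).
Qed.

End TripletLocal.

Section InvariantForms.
Variables (K : fieldType) (g : gradedLie K) (B : g -> g -> K).
Hypotheses (bB : bilinear_form B) (oB : degree_orthogonal B).

Lemma form_linr x : linear (B x : g -> K^o). Proof. exact: bB.1. Qed.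
Lemma form_linl y : linear ((fun x => B x y) : g -> K^o). Proof. exact: bB.2. Qed.

Lemma form_gcomp i x y : gdeg i x -> B x (gcomp (- i) y) = B x y.
Proof.
move=> xi; have [s [us s0 yE]] := gcomp_sum y.
rewrite [in RHS]yE (lin_sum (form_linr x)).
have h j : j != - i -> B x (gcomp j y) = 0.
  by move=> ji; apply: oB xi (gcompP j y) => e; move: ji; rewrite e opprK eqxx.
have [si|si] := boolP (- i \in s).
  by rewrite (bigD1_seq (- i)) //= big1 ?addr0.
rewrite (s0 _ si) (lin0 (form_linr x)) big_seq big1 // => j js; apply: h.
by apply: contraNneq si => <-.
Qed.

(** An invariant form is determined by its values on the local part, since
    B([a, z], y) = B(a, [z, y]) lowers degrees. *)
Lemma invariant_form_local_eq0 : invariant_form B -> symmetric_form B ->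
  (forall i x y, (`|i|%N <= 1)%N -> gdeg i x -> gdeg (- i) y -> B x y = 0) ->
  forall x y, B x y = 0.
Proof.
move=> iB sB h x y; move: x; apply: (@homogeneous_ind _ _ [set x | B x y = 0]%classic).
  split=> [|a u v /= hu hv]; first by rewrite /= (lin0 (form_linl y)).
  by rewrite form_linl hu hv scaler0 addr0.
move=> i x xi /=; rewrite -(form_gcomp y xi).
have lowered e k a z y' : (`|e|%N <= 1)%N -> i = e + k -> gdeg e a -> gdeg k z ->
    gdeg (- i) y' -> B \[a, z\] y' = 0.
  move=> e1 ek ae zk yi; rewrite iB; apply: h e1 ae _.
  by apply: gdegS (gdeg_bracket zk yi) _; rewrite ek opprD addrCA subrr addr0.
have lspan0 e k x' : (`|e|%N <= 1)%N -> i = e + k ->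
    lspan (brackets_of (@gdeg _ g e) (gdeg k)) x' -> B x' (gcomp (- i) y) = 0.
  move=> e1 ek; move: x'.
  suff: (lspan (brackets_of (@gdeg _ g e) (gdeg k)) `<=`
    [set x' | B x' (gcomp (- i) y) = 0])%classic by [].
  apply: lspan_min => [|_ [a [z [ae zk ->]]] /=].
    split=> [|a u v /= hu hv]; first by rewrite /= (lin0 (form_linl _)).
    by rewrite form_linl hu hv scaler0 addr0.
  exact: (lowered e k) (gcompP _ _).
have [i1|i1] := boolP (`|i|%N <= 1)%N; first exact: h (gcompP _ _).
have [i2|i2] : 2 <= i \/ i <= -2 by lia.
  apply: (lspan0 1 (i - 1)) => //; first by lia.
  by rewrite -gdeg_succ; [apply: gdegS xi _; lia|lia].
apply: (lspan0 (-1) (i + 1)) => //; first by lia.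
by rewrite -gdeg_pred; [apply: gdegS xi _; lia|lia].
Qed.

End InvariantForms.

Section LocalCoordinates.
Variables (K : fieldType) (g : gradedLie K).

Lemma local_coordinate (U : lmodType K) (i : int) (f : U -> g) :
  linear f -> set_bij setT (gdeg i) f ->
  exists q : g -> U, linear q /\ forall x, f (q x) = gcomp i x.
Proof.
move=> lf [_ fi fs].
have /choice[q qP] : forall x, exists u, f u = gcomp i x.
  by move=> x; have [u _ <-] := fs _ (gcompP i x); exists u.
exists q; split=> // a x y; apply: fi; rewrite ?in_setT //.
by rewrite lf !qP gcomp_linear.
Qed.

End LocalCoordinates.

(** * The extended form *)

Section ExtendedForm.
Variables (K : fieldType) (T : triplet K).
Local Notation V := (tV T).
Local Notation g0 := (tg0 T).

(** The extension of the form that is B_0 in degree 0 and the evaluation pairing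
    between degrees 1 and -1. Its local invariance amounts to
    B_0([X, Y], u) = Y(rho(u) X), up to signs, in each of the six arrangements of
    X, Y and u. *)
Lemma extended_form_exists (g : gradedLie K) (iota : local_map (Gamma T) g) :
  local_isomorphism iota -> exists B, extended_form iota B.
Proof.
move=> [[[/= lm l0 lp] [/= dm d0 dp] [/= b00 b0m b0p bpm]] bijm bij0 bijp].
have [qm [lqm qmE]] := local_coordinate lm bijm.
have [q0 [lq0 q0E]] := local_coordinate l0 bij0.
have [qp [lqp qpE]] := local_coordinate lp bijp.
have [_ im sm] := bijm; have [_ i0 s0] := bij0; have [_ ip sp] := bijp.
have qmK Y : qm (fm1 iota Y) = Y.
  by apply: im; rewrite ?in_setT // qmE gcomp_id.
have q0K u : q0 (f0 iota u) = u.
  by apply: i0; rewrite ?in_setT // q0E gcomp_id.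
have qpK X : qp (fp1 iota X) = X.
  by apply: ip; rewrite ?in_setT // qpE gcomp_id.
have qm0 i x : gdeg i x -> i <> -1 -> qm x = 0.
  move=> xi ne; apply: im; rewrite ?in_setT // qmE (lin0 lm).
  by apply: gcomp_neq xi _ => e; apply: ne.
have q00 i x : gdeg i x -> i <> 0 -> q0 x = 0.
  move=> xi ne; apply: i0; rewrite ?in_setT // q0E (lin0 l0).
  by apply: gcomp_neq xi _ => e; apply: ne.
have qp0 i x : gdeg i x -> i <> 1 -> qp x = 0.
  move=> xi ne; apply: ip; rewrite ?in_setT // qpE (lin0 lp).
  by apply: gcomp_neq xi _ => e; apply: ne.
have [br bl] := tB0_bilinear T.
pose beta x y : K := tB0 (q0 x) (q0 y) + (qm y (qp x) + qm x (qp y)).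
have beta_sym : symmetric_form beta.
  by move=> x y; rewrite /beta tB0_symmetric; congr (_ + _); rewrite addrC.
have beta_r x : scalar (beta x).
  move=> a y z; rewrite /beta lq0 br lqm lqp linearP /= add_lfunE scale_lfunE.
  by rewrite !mulrDr [X in _ + X = _]addrACA [LHS]addrACA.
have beta_bilin : bilinear_form beta.
  split=> // y a x z; rewrite ![beta _ y]beta_sym; exact: beta_r.
have B0r (u : g0) : tB0 u 0 = 0 by rewrite (lin0 (scalar_linear (br u))).
have B0l (u : g0) : tB0 0 u = 0 by rewrite (lin0 (scalar_linear (bl u))).
have betamp Y X : beta (fm1 iota Y) (fp1 iota X) = Y X.
  rewrite /beta qmK qpK (q00 _ _ (dm Y)) // B0l (qm0 _ _ (dp X)) //.
  by rewrite zero_lfunE !add0r.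
have beta00 u v : beta (f0 iota u) (f0 iota v) = tB0 u v.
  rewrite /beta !q0K (qm0 _ _ (d0 u)) // (qm0 _ _ (d0 v)) // !zero_lfunE.
  by rewrite !addr0.
have betapm X Y : beta (fp1 iota X) (fm1 iota Y) = Y X by rewrite beta_sym.
have beta_orth : degree_orthogonal beta.
  move=> i j x y ij xi yj; rewrite /beta.
  have -> : tB0 (q0 x) (q0 y) = 0.
    have [i0'|/eqP i0'] := eqVneq i 0; last by rewrite (q00 _ _ xi).
    by rewrite (q00 _ _ yj) //; lia.
  have cross i' j' x' y' : i' <> - j' -> gdeg i' x' -> gdeg j' y' -> qm y' (qp x') = 0.
    move=> ij' xi' yj'; have [j1|/eqP j1] := eqVneq j' (-1).
      by rewrite (qp0 _ _ xi') ?linear0 // => i1; apply: ij'; rewrite i1 j1.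
    by rewrite (qm0 _ _ yj') // zero_lfunE.
  rewrite (cross i j) // (cross j i) ?addr0 // => e; apply: ij; rewrite e; lia.
have beta_inv i j k x y z : (`|i|%N <= 1)%N -> (`|j|%N <= 1)%N -> (`|k|%N <= 1)%N ->
    i + j + k = 0 -> gdeg i x -> gdeg j y -> gdeg k z ->
    beta \[x, y\] z = beta x \[y, z\].
  have loc e w : (`|e|%N <= 1)%N -> gdeg e w ->
      [\/ e = -1 /\ exists Y, w = fm1 iota Y, e = 0 /\ exists u, w = f0 iota u
        | e = 1 /\ exists X, w = fp1 iota X].
    move=> e1; have [|[|]] : e = -1 \/ e = 0 \/ e = 1 by lia.
    - by move=> -> /sm[Y _ <-]; constructor 1; split=> //; exists Y.
    - by move=> -> /s0[Y _ <-]; constructor 2; split=> //; exists Y.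
    - by move=> -> /sp[Y _ <-]; constructor 3; split=> //; exists Y.
  have Nr u v : beta u (- v) = - beta u v by rewrite (linN (scalar_linear (beta_r u))).
  have Nl u v : beta (- u) v = - beta u v by rewrite beta_sym Nr beta_sym.
  have bm0 Y u : \[fm1 iota Y, f0 iota u\] = - fm1 iota (contragredient u Y).
    by rewrite br_anti b0m.
  have bp0 X u : \[fp1 iota X, f0 iota u\] = - fp1 iota (trho u X).
    by rewrite br_anti b0p.
  have bmp X Y : \[fm1 iota Y, fp1 iota X\] = - f0 iota (moment X Y).
    by rewrite br_anti bpm.
  have mE X Y u : tB0 u (moment X Y) = Y (trho u X) by rewrite tB0_symmetric momentE.
  move=> i1 j1 k1 + xi yj zk.
  case: (loc _ _ i1 xi) (loc _ _ j1 yj) (loc _ _ k1 zk) =>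
    -[-> [x1 ->]] [] [-> [y1 ->]] [] [-> [z1 ->]] // _;
    rewrite -?(b00, b0m, b0p, bpm) ?(bm0, bp0, bmp, Nr, Nl);
    rewrite ?(beta00, betamp, betapm) ?contragredientE ?momentE ?mE ?opprK //.
  exact: tB0_invariant.
exists (extension beta_bilin beta_orth beta_inv); split.
- exact: extension_bilinear.
- exact: extension_symmetric.
- exact: extension_invariant.
- exact: extension_orthogonal.
split=> [u v|X Y]; rewrite extension_local //.
  by exists 0.
by exists 1.
Qed.

End ExtendedForm.

(** * The minimal graded Lie algebra *)

Section LocalPart.
Variables (K : fieldType) (g h : gradedLie K).

Lemma local_part_gcomp (x : g) i : local_part x -> (1 < `|i|)%N -> gcomp i x = 0.
Proof.
move=> [a [b [c [am b0 cp ->]]]] i1; have l := @gcomp_linear _ g i.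
rewrite !(linD l) (gcomp_neq am) ?(gcomp_neq b0) ?(gcomp_neq cp) ?addr0 //; lia.
Qed.

Lemma local_homogeneous_part (x : g) : local_homogeneous x -> local_part x.
Proof.
have z i : @gdeg K g i 0 by apply: subspace0; apply: gdeg_subspace.
case/local_homogeneousP => [[]|] h0.
- by exists x, 0, 0; split=> //; rewrite !addr0.
- by exists 0, x, 0; split=> //; rewrite addr0 add0r.
- by exists 0, 0, x; split=> //; rewrite !add0r.
Qed.

Lemma kernel_local_part (p : g -> h) : graded_morphism p ->
  (forall x, local_homogeneous x -> p x = 0 -> x = 0) ->
  ([set x | p x = 0] `&` @local_part K g = [set 0])%classic.
Proof.
move=> mp inj; have [lp _ _] := mp.
apply/seteqP; split=> [x [/= px lx]|_ ->]; last first.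
  split; first exact: (lin0 lp).
  apply: local_homogeneous_part; exists 0 => //.
  by apply: subspace0; apply: gdeg_subspace.
apply: gcomp_eq0 => i; have [i1|i1] := leqP `|i|%N 1; last exact: local_part_gcomp.
apply: inj; first by exists i => //; apply: gcompP.
by rewrite (morphism_gcomp mp) px (lin0 (gcomp_linear _)).
Qed.

Lemma ideal_local_homogeneous (I : set g) x :
  (I `&` @local_part K g = [set 0])%classic -> I x -> local_homogeneous x -> x = 0.
Proof.
move=> I0 Ix lx; suff: (I `&` @local_part K g)%classic x by rewrite I0.
by split=> //; apply: local_homogeneous_part.
Qed.

(** In a transitive quotient, a nonzero homogeneous element has a nonzero bracket
    with degree -1 or 1, so a nonzero image of I could be moved down to the local
    part, where I vanishes. *)
Lemma transitive_kernel_contains (p : g -> h) (I : set g) :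
  graded_morphism p -> set_surj setT setT p -> transitive_graded h ->
  graded_ideal I -> (I `&` @local_part K g = [set 0])%classic ->
  (I `<=` [set x | p x = 0])%classic.
Proof.
move=> mp sp [trp trm] [sI bI dI] I0; have [lp dp bp] := mp.
have hom (n : nat) i x : (`|i| <= n)%N -> I x -> gdeg i x -> p x = 0.
  elim: n i x => [|n IH] i x ni Ix xi.
    by rewrite (ideal_local_homogeneous I0 Ix) ?(lin0 lp) //; exists i => //; lia.
  have [i1|i1] := leqP `|i|%N 1.
    by rewrite (ideal_local_homogeneous I0 Ix) ?(lin0 lp) //; exists i.
  have ad e z : (`|(i + e)%R| <= n)%N -> gdeg e z -> p \[x, z\] = 0.
    move=> ie ze; apply: (IH (i + e)) => //; last exact: gdeg_bracket.
    by rewrite br_anti; apply: (subspaceN sI); apply: bI.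
  have [i2|i2] : 2 <= i \/ i <= -2 by lia.
    apply: (trp i); [by lia|exact: dp|move=> y ym].
    have [z zm <-] := morphism_gdeg_surj mp sp ym.
    by rewrite -bp; apply: ad zm; lia.
  apply: (trm i); [by lia|exact: dp|move=> y ym].
  have [z zm <-] := morphism_gdeg_surj mp sp ym.
  by rewrite -bp; apply: ad zm; lia.
move=> x /dI[s [c [Ic ->]]] /=; rewrite (lin_sum lp); apply: big1 => i _.
by have [Ici ci] := Ic i; apply: (hom _ i).
Qed.

Lemma transitive_kernel_Jmax (p : g -> h) :
  graded_morphism p -> set_surj setT setT p -> transitive_graded h ->
  (forall x, local_homogeneous x -> p x = 0 -> x = 0) ->
  is_Jmax [set x | p x = 0]%classic.
Proof.
move=> mp sp tr inj; split.
  by split; [apply: morphism_kernel_ideal|apply: kernel_local_part].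
move=> I [iI I0] kI; apply/seteqP; split=> //.
exact: transitive_kernel_contains.
Qed.

End LocalPart.

Section TransitiveForm.
Variables (K : fieldType) (T : triplet K) (G : quadGradedLie K).
Variable iota : local_map (Gamma T) G.

(** In degrees 0, 1 and -1 this is local transitivity. Let x of degree i > 1
    commute with degree -1. Degree -i is spanned by brackets [a, z] with a of
    degree -1, and B(x, [a, z]) = B([x, a], z) = 0, so x is orthogonal to
    everything; the argument for i < -1 is symmetric. *)
Lemma nondegenerate_transitive : admissible T -> local_morphism iota ->
  set_surj setT (gdeg (-1)) (fm1 iota) -> set_surj setT (gdeg 0) (f0 iota) ->
  set_surj setT (gdeg 1) (fp1 iota) ->
  injective (fm1 iota) -> injective (f0 iota) -> injective (fp1 iota) ->
  transitive_graded G.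
Proof.
move=> adm [[/= lm l0 lp] [/= dm d0 dp] [/= b00 b0m b0p bpm]] sm s0 sp im i0 ip.
have [tr0 trp trm] := admissible_locally_transitive adm.
have bG := @qform_bilinear _ G; have oG := @qform_orthogonal _ G.
have lowered e i k (x : G) : i = - (e + k) -> gdeg i x ->
    (forall y, gdeg e y -> \[x, y\] = 0) ->
    @gdeg _ G (- i) = lspan (brackets_of (gdeg e) (gdeg k)) -> x = 0.
  move=> ek xi h spn; apply: (@qform_nondegenerate _ G) => y.
  rewrite -(form_gcomp bG oG y xi); have := gcompP (- i) y; rewrite spn.
  move: (gcomp _ _).
  suff: (lspan (brackets_of (@gdeg _ G e) (gdeg k)) `<=` [set z | qform x z = 0])%classic by [].
  apply: lspan_min => [|_ [a [z [ae zk ->]]] /=].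
    split=> [|a u v /= hu hv]; first by rewrite /= (lin0 (form_linr bG _)).
    by rewrite (form_linr bG) hu hv scaler0 addr0.
  by rewrite -(@qform_invariant _ G) h // (lin0 (form_linl bG _)).
split=> i x i0' xi h.
  have [|[|i2]] : i = 0 \/ i = 1 \/ 2 <= i by lia.
  - move=> ei; rewrite ei in xi; have [u _ ux] := s0 _ xi; rewrite -ux.
    rewrite (tr0 u) ?(lin0 l0) // => X; apply: dual_separates => Y.
    have : contragredient u Y = 0.
      by apply: im; rewrite b0m (lin0 lm) ux; apply: h.
    move=> /(congr1 (fun phi : dual (tV T) => phi X)).
    by rewrite contragredientE zero_lfunE => /eqP; rewrite oppr_eq0 => /eqP.
  - move=> ei; rewrite ei in xi; have [X _ Xx] := sp _ xi; rewrite -Xx.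
    rewrite (trp X) ?(lin0 lp) // => Y.
    by apply: i0; rewrite /= bpm (lin0 l0) Xx; apply: h.
  apply: (lowered (-1) i (1 - i)) => //; first by lia.
  by rewrite -gdeg_pred; [congr gdeg; lia|lia].
have [|[|i2]] : i = 0 \/ i = -1 \/ i <= -2 by lia.
- move=> ei; rewrite ei in xi; have [u _ ux] := s0 _ xi; rewrite -ux.
  rewrite (tr0 u) ?(lin0 l0) // => X.
  by apply: ip; rewrite /= b0p (lin0 lp) ux; apply: h.
- move=> ei; rewrite ei in xi; have [Y _ Yx] := sm _ xi; rewrite -Yx.
  rewrite (trm Y) ?(lin0 lm) // => X.
  apply: i0; rewrite /= bpm (lin0 l0) Yx br_anti h ?oppr0 //.
apply: (lowered 1 i (-1 - i)) => //; first by lia.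
by rewrite -gdeg_succ; [congr gdeg; lia|lia].
Qed.

End TransitiveForm.

Lemma local_morphism_comp (K : fieldType) (G : localLie K) (g h : gradedLie K)
    (p : g -> h) (f : local_map G g) :
  graded_morphism p -> local_morphism f -> local_morphism (local_map_comp p f).
Proof.
move=> [lp dp bp] [[lm l0 lpp] [dm d0 dpp] [b00 b0m b0p bpm]]; split.
- by split; apply: linear_comp.
- by split=> x; apply: dp.
by split=> u v /=; rewrite ?b00 ?b0m ?b0p ?bpm bp.
Qed.

Section RadicalQuotient.
Variables (K : fieldType) (g : gradedLie K) (B : g -> g -> K).
Hypotheses (bB : bilinear_form B) (sB : symmetric_form B)
  (iB : invariant_form B) (oB : degree_orthogonal B).

Definition radical_setoid : lieSetoid K.
Proof.
apply: (@LieSetoid K g (fun x y => forall z, B x z = B y z) 0 +%R (fun x => - x)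
  (fun a x => a *: x) (fun x y => \[x, y\])).
- by [].
- by move=> x y h z; rewrite h.
- by move=> x y z h1 h2 t; rewrite h1 h2.
- by move=> x x' y y' h1 h2 z; rewrite !(linD (form_linl bB z)) h1 h2.
- by move=> x x' h z; rewrite !(linN (form_linl bB z)) h.
- by move=> a x x' h z; rewrite !(linZ (form_linl bB z)) h.
- move=> x x' y y' h1 h2 z; rewrite iB h1 -iB [in LHS]br_anti [in RHS]br_anti.
  by rewrite !(linN (form_linl bB z)) !iB h2.
- by move=> x y z t; rewrite addrA.
- by move=> x y z; rewrite addrC.
- by move=> x z; rewrite add0r.
- by move=> x z; rewrite addNr.
- by move=> a b x z; rewrite scalerA.
- by move=> x z; rewrite scale1r.
- by move=> a x y z; rewrite scalerDr.
- by move=> x a b z; rewrite scalerDl.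
- by move=> x a y z t; rewrite br_linr.
- by move=> x a y z t; rewrite br_linl.
- by move=> x z; rewrite bracketxx.
- by move=> x y z t; rewrite bracket_jacobi.
Defined.

(** By orthogonality of degrees the components of a radical element are radical,
    so the quotient inherits the grading. *)
Lemma radical_quotient : exists (G : quadGradedLie K) (p : g -> G),
  [/\ graded_morphism p, set_surj setT setT p,
      forall x y, qform (p x) (p y) = B x y
    & forall x, p x = 0 <-> forall y, B x y = 0].
Proof.
have [L [p [psurj peq pD pZ pB]]] : exists (L : lieType K) (p : g -> L),
    [/\ forall c, exists x, p x = c,
        forall x y, p x = p y <-> (forall z, B x z = B y z),
        {morph p : x y / x + y}, forall a x, p (a *: x) = a *: p x
      & forall x y, p \[x, y\] = \[p x, p y\]].
  exact: (lie_quotient radical_setoid).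
have lp : linear (p : g -> L) by move=> a x y; rewrite -pZ -pD.
have BL z : linear ((fun x => B x z) : g -> K^o) by apply: form_linl.
have p0 x : p x = 0 <-> forall y, B x y = 0.
  rewrite -(lin0 lp); split=> [/peq/= h y|h].
    by rewrite h (lin0 (BL y)).
  by apply/peq => y /=; rewrite h (lin0 (BL y)).
pose D i : set L := (p @` (@gdeg K g i))%classic.
have D_fin i : fin_dim (D i) by exact: (fin_dim_image lp (@gdeg_fin_dim _ g i)).
have D_span x : is_sum_of D x.
  have [y <-] := psurj x; have [s [us s0 yE]] := gcomp_sum y.
  exists s, (fun i => p (gcomp i y)); split=> [i|].
    by exists (gcomp i y) => //; apply: gcompP.
  by rewrite {1}yE (lin_sum lp).
have D_indep (s : seq int) (c : int -> L) : uniq s -> (forall i, D i (c i)) ->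
    \sum_(i <- s) c i = 0 -> forall i, i \in s -> c i = 0.
  move=> us Dc sc i si.
  have /choice[d dP] : forall i, exists d : g, gdeg i d /\ p d = c i.
    by move=> j; have [d dj pd] := Dc j; exists d.
  rewrite -(dP i).2; apply/p0 => y; rewrite -(form_gcomp bB oB y (dP i).1).
  have : p (\sum_(i <- s) d i) = 0.
    by rewrite (lin_sum lp) -[RHS]sc; apply: eq_bigr => j _; rewrite (dP j).2.
  move=> /p0 /(_ (gcomp (- i) y)); rewrite (lin_sum (BL _)) (bigD1_seq i) //=.
  rewrite big1 ?addr0 // => j ji; apply: oB (dP j).1 (gcompP _ _) => e.
  by move: ji; rewrite e opprK eqxx.
have D_br i j x y : D i x -> D j y -> D (i + j) \[x, y\].
  move=> [a ai <-] [b bj <-]; exists \[a, b\]; first exact: gdeg_bracket.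
  exact: pB.
have D_gen : smallest subalgebra (D (-1) `|` D 0 `|` D 1)%classic = setT.
  apply/seteqP; split=> // x _ S [[[S0 Slin] Sbr] SD].
  have [y <-] := psurj x; move: y.
  apply: (@generated_subalgebra_ind _ _ (p @^-1` S)%classic).
    split; first exact: preimage_subspace.
    by move=> a b Sa Sb; rewrite /= pB; apply: Sbr.
  move=> y ly; apply: SD; move: ly => /local_homogeneousP[[]|] h.
  - by left; left; exists y.
  - by left; right; exists y.
  - by right; exists y.
pose gq := @GradedLie K L D D_fin D_span D_indep D_br D_gen.
have /choice[r rP] := psurj.
pose Bq (x y : gq) : K := B (r x) (r y).
have rpB x z : B (r (p x)) z = B x z.
  by have /peq := rP (p x); apply.
have BqE x y : Bq (p x) (p y) = B x y by rewrite /Bq rpB sB rpB sB.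
have Bq_bil : bilinear_form Bq.
  split=> [x a y z|x a y z]; have [x' <-] := psurj x; have [y' <-] := psurj y;
    have [z' <-] := psurj z; rewrite -pZ -pD !BqE /=.
  - exact: bB.1.
  - exact: bB.2.
have Bq_sym : symmetric_form Bq by move=> x y; apply: sB.
have Bq_inv : invariant_form Bq.
  move=> x y z; have [x' <-] := psurj x; have [y' <-] := psurj y.
  by have [z' <-] := psurj z; rewrite -!pB !BqE /= iB.
have Bq_nd : nondegenerate_form Bq.
  move=> x h; have [x' ex] := psurj x; rewrite -ex; apply/p0 => y.
  by rewrite -BqE ex.
have Bq_orth : degree_orthogonal Bq.
  by move=> i j x y ij [a ai <-] [b bj <-]; rewrite BqE; apply: oB ij ai bj.
exists (@QuadGradedLie K gq Bq Bq_bil Bq_sym Bq_inv Bq_nd Bq_orth), p.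
split=> //; first split=> //.
- by move=> i x xi; exists x.
- by move=> x _; have [y <-] := psurj x; exists y.
Qed.

End RadicalQuotient.

Section MinimalAlgebra.
Variables (K : fieldType) (T : triplet K).

(** The quotient by the radical of B is transitive, so its kernel is J_max. It
    does not meet the local part because B restricts there to B_0 and the
    evaluation pairing, which are non-degenerate. *)
Lemma gmin_exists : admissible T ->
  exists G : quadGradedLie K, is_gmin_with_form T G /\ transitive_graded G.
Proof.
move=> adm; have [gM [j gmax]] := gmax_exists (admissible_locally_transitive adm).
have lij := gmax.1; have [mj bijm bij0 bijp] := lij.
have [B [bB sB iB oB [B0 Bp]]] := extended_form_exists lij.
have [G [p [mp sp qB p0]]] := radical_quotient bB sB iB oB.
have [[lm l0 lp] [dm d0 dp] _] := mj.
have [_ _ sm] := bijm; have [_ _ s0] := bij0; have [_ _ sp1] := bijp.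
pose iota := local_map_comp p j.
have miota : local_morphism iota by apply: local_morphism_comp.
have [[/= lm' l0' lp'] _ _] := miota.
have km Y : p (fm1 j Y) = 0 -> Y = 0.
  by move=> /p0 h; apply/lfunP => X; rewrite zero_lfunE -Bp sB h.
have k0 u : p (f0 j u) = 0 -> u = 0.
  by move=> /p0 h; apply: (@tB0_nondegenerate _ T) => v; rewrite -B0 h.
have kp X : p (fp1 j X) = 0 -> X = 0.
  by move=> /p0 h; apply: dual_separates => Y; rewrite -Bp h.
have inj x : local_homogeneous x -> p x = 0 -> x = 0.
  case/local_homogeneousP => [[/sm|/s0]|/sp1] [u _ <-].
  - by move=> /km ->; rewrite (lin0 lm).
  - by move=> /k0 ->; rewrite (lin0 l0).
  - by move=> /kp ->; rewrite (lin0 lp).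
have injl (U : lmodType K) (f : U -> G) : linear f -> (forall x, f x = 0 -> x = 0) -> injective f.
  move=> lf h x y e; apply/eqP; rewrite -subr_eq0; apply/eqP; apply: h.
  by rewrite (linB lf) e subrr.
have tr : transitive_graded G.
  apply: (nondegenerate_transitive adm miota).
  - move=> y ym; have [x xm <-] := morphism_gdeg_surj mp sp ym.
    by have [Y _ <-] := sm _ xm; exists Y.
  - move=> y ym; have [x xm <-] := morphism_gdeg_surj mp sp ym.
    by have [Y _ <-] := s0 _ xm; exists Y.
  - move=> y ym; have [x xm <-] := morphism_gdeg_surj mp sp ym.
    by have [Y _ <-] := sp1 _ xm; exists Y.
  - exact: injl.
  - exact: injl.
  - exact: injl.
exists G; split=> //; exists iota; split.
  exists gM, j, p; split=> //.
  exact: transitive_kernel_Jmax.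
split.
- exact: qform_bilinear.
- exact: qform_symmetric.
- exact: qform_invariant.
- exact: qform_orthogonal.
by split=> [u v|X Y]; rewrite /= qB.
Qed.

End MinimalAlgebra.

(** * Comparison of local parts *)

Lemma bijective_inj_surj (S U : Type) (f : S -> U) :
  injective f -> (forall y, exists x, f x = y) -> bijective f.
Proof.
move=> inj /choice[r rP]; exists r => // x.
by apply: inj; rewrite rP.
Qed.

Lemma bijective_surj (S U : Type) (f : S -> U) : bijective f -> forall y, exists x, f x = y.
Proof. by case=> r _ rK y; exists (r y). Qed.

Lemma linear_hom (K : fieldType) (U V : vectType K) (f : U -> V) : linear f ->
  exists F : 'Hom(U, V), forall x, F x = f x.
Proof.
move=> lf; pose f' : {linear U -> V} :=
  HB.pack f (GRing.isLinear.Build K U V *:%R f lf).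
by exists (linfun f') => x; rewrite lfunE.
Qed.

Section MinimalLocal.
Variable K : fieldType.

Lemma local_isomorphism_injective (G : localLie K) (g h : gradedLie K)
    (iota : local_map G g) (p : g -> h) :
  local_isomorphism iota -> graded_morphism p -> set_surj setT setT p ->
  (forall x, local_homogeneous x -> p x = 0 -> x = 0) ->
  local_isomorphism (local_map_comp p iota).
Proof.
move=> [mi bm b0 bp] mp sp inj; have mc := local_morphism_comp mp mi.
have [[lm l0 lp] [dm d0 dp] _] := mi; have [lpp dpp _] := mp.
have bij i (U : lmodType K) (f : U -> g) : (`|i| <= 1)%N -> linear f ->
    set_bij setT (gdeg i) f -> set_bij setT (gdeg i) (p \o f).
  move=> i1 lf [ff fi fs]; split.
  - by move=> x _; apply: dpp; apply: ff.
  - move=> x y _ _ /= e; apply: fi; rewrite ?in_setT //.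
    apply/eqP; rewrite -subr_eq0 -(linB lf); apply/eqP; apply: inj.
      by exists i => //; apply: ff.
    by rewrite (linB lf) (linB lpp) e subrr.
  move=> y yi; have [x xi <-] := morphism_gdeg_surj mp sp yi.
  by have [u _ <-] := fs _ xi; exists u.
by split=> //; apply: bij.
Qed.

Lemma gmin_local_isomorphism (G : localLie K) (g : gradedLie K)
    (iota : local_map G g) : is_gmin iota -> local_isomorphism iota.
Proof.
move=> [gM [j [p [[lj _] mp sp [[_ I0] _] ->]]]].
apply: local_isomorphism_injective => // x lx px.
exact: (ideal_local_homogeneous I0 px lx).
Qed.

Lemma local_isomorphism_homogeneous (G : localLie K) (g : gradedLie K)
    (iota : local_map G g) x : local_isomorphism iota -> local_homogeneous x ->
  [\/ exists y, x = fm1 iota y, exists u, x = f0 iota u | exists z, x = fp1 iota z].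
Proof.
move=> [_ [_ _ sm] [_ _ s0] [_ _ sp]] /local_homogeneousP[[/sm|/s0]|/sp] [u _ <-].
- by constructor 1; exists u.
- by constructor 2; exists u.
- by constructor 3; exists u.
Qed.

Lemma local_isomorphism_inj (G : localLie K) (g : gradedLie K)
    (iota : local_map G g) : local_isomorphism iota ->
  [/\ injective (fm1 iota), injective (f0 iota) & injective (fp1 iota)].
Proof.
move=> [_ [_ im _] [_ i0 _] [_ ip _]].
by split=> x y e; [apply: im|apply: i0|apply: ip]; rewrite ?in_setT.
Qed.

(** Two transitive quotients of the same algebra with the same local part have
    the same kernel. *)
Lemma transitive_quotient_iso (g h1 h2 : gradedLie K) (p1 : g -> h1) (p2 : g -> h2) :
  graded_morphism p1 -> graded_morphism p2 ->
  set_surj setT setT p1 -> set_surj setT setT p2 ->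
  transitive_graded h1 -> transitive_graded h2 ->
  (forall x, local_homogeneous x -> p1 x = 0 -> x = 0) ->
  (forall x, local_homogeneous x -> p2 x = 0 -> x = 0) ->
  exists Psi : h1 -> h2,
    [/\ graded_morphism Psi, bijective Psi & forall x, Psi (p1 x) = p2 x].
Proof.
move=> mp1 mp2 sp1 sp2 tr1 tr2 i1 i2.
have ker x : p1 x = 0 <-> p2 x = 0.
  split.
    apply: (transitive_kernel_contains mp2 sp2 tr2 (morphism_kernel_ideal mp1)).
    exact: kernel_local_part.
  apply: (transitive_kernel_contains mp1 sp1 tr1 (morphism_kernel_ideal mp2)).
  exact: kernel_local_part.
have [[l1 d1 b1] [l2 d2 b2]] := (mp1, mp2).
have ker2 x y : p1 x = p1 y <-> p2 x = p2 y.
  have sub (U V : zmodType) (a b : V) : a = b <-> a - b = 0.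
    by split=> [->|/eqP]; rewrite ?subrr // subr_eq0 => /eqP.
  by rewrite (sub h1) // (sub h1 h2) // -(linB l1) -(linB l2).
have s1 y : exists x, p1 x = y by have [x _ <-] := sp1 y I; exists x.
have s2 y : exists x, p2 x = y by have [x _ <-] := sp2 y I; exists x.
have /choice[r rP] := s1.
pose Psi y := p2 (r y).
have PsiE x : Psi (p1 x) = p2 x by apply/ker2; rewrite rP.
exists Psi; split=> //.
  split.
  - move=> a x y; have [x' <-] := s1 x; have [y' <-] := s1 y.
    by rewrite -l1 !PsiE l2.
  - move=> i y yi; have [x xi <-] := morphism_gdeg_surj mp1 sp1 yi.
    by rewrite PsiE; apply: d2.
  move=> x y; have [x' <-] := s1 x; have [y' <-] := s1 y.
  by rewrite -b1 !PsiE b2.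
apply: bijective_inj_surj => [x y|y].
  by have [x' <-] := s1 x; have [y' <-] := s1 y; rewrite !PsiE => /ker2.
by have [x <-] := s2 y; exists (p1 x).
Qed.

(** The universal property extends kappa to a morphism from the maximal algebra
    onto G2, whose kernel is that of the projection to G1. The difference of the
    two forms is invariant and vanishes on the local part. *)
Lemma gmin_unique (T : triplet K) (G1 G2 : quadGradedLie K)
    (iota : local_map (Gamma T) G1) (kappa : local_map (Gamma T) G2) :
  is_gmin iota -> extended_form iota (@qform K G1) -> transitive_graded G1 ->
  local_isomorphism kappa -> extended_form kappa (@qform K G2) ->
  transitive_graded G2 -> quad_iso G1 G2.
Proof.
move=> gi [_ _ _ _ [e0 ep]] tr1 lk [_ _ _ _ [k0 kp]] tr2.
have li := gmin_local_isomorphism gi.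
have [gM [j [p [[lj univ] mp sp Jmax iotaE]]]] := gi.
have [mk _ _ _] := lk; have [phi [[mphi phiE] _]] := univ G2 kappa mk.
have [km k00 kpp] : [/\ forall y, phi (fm1 j y) = fm1 kappa y,
    forall u, phi (f0 j u) = f0 kappa u & forall x, phi (fp1 j x) = fp1 kappa x].
  by split=> x; rewrite -phiE.
have [pm p00 ppp] : [/\ forall y, p (fm1 j y) = fm1 iota y,
    forall u, p (f0 j u) = f0 iota u & forall x, p (fp1 j x) = fp1 iota x].
  by split=> x; rewrite iotaE.
have [injm inj0 injp] := local_isomorphism_inj lk.
have [[[lkm lk0 lkp] _ _] _ _ _] := lk; have [[[ljm lj0 ljp] _ _] _ _ _] := lj.
have sphi : set_surj setT setT phi.
  apply: morphism_surj => // y /(local_isomorphism_homogeneous lk)[] [u ->].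
  - by exists (fm1 j u).
  - by exists (f0 j u).
  - by exists (fp1 j u).
have iphi x : local_homogeneous x -> phi x = 0 -> x = 0.
  case/(local_isomorphism_homogeneous lj) => [] [u ->]; rewrite ?km ?k00 ?kpp => h.
  - by rewrite (injm u 0) ?(lin0 ljm) // h (lin0 lkm).
  - by rewrite (inj0 u 0) ?(lin0 lj0) // h (lin0 lk0).
  - by rewrite (injp u 0) ?(lin0 ljp) // h (lin0 lkp).
have ip x : local_homogeneous x -> p x = 0 -> x = 0.
  by move=> lx px; apply: (ideal_local_homogeneous Jmax.1.2).
have [Psi [mPsi bPsi PsiE]] := transitive_quotient_iso mp mphi sp sphi tr1 tr2 ip iphi.
exists Psi; split=> // x y.
have [lPsi dPsi brPsi] := mPsi.
have [b1 b2] := (@qform_bilinear _ G1, @qform_bilinear _ G2).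
pose D x y : K := qform (Psi x) (Psi y) - qform x y.
apply/eqP; rewrite -subr_eq0 -[_ - _]/(D x y); apply/eqP.
have sD : symmetric_form D.
  by move=> u v; rewrite /D qform_symmetric [qform u v]qform_symmetric.
apply: (@invariant_form_local_eq0 _ _ D) => //.
- have Dr u : scalar (D u).
    move=> a v w; rewrite /D lPsi (b2.1 (Psi u)) (b1.1 u).
    by rewrite opprD mulrBr addrACA.
  by split=> // u a v w; rewrite ![D _ u]sD; apply: Dr.
- move=> i k u v ik ui vk; rewrite /D.
  rewrite (@qform_orthogonal _ G1 _ _ _ _ ik ui vk).
  by rewrite (@qform_orthogonal _ G2 _ _ _ _ ik (dPsi _ _ ui) (dPsi _ _ vk)) subrr.
- by move=> u v w; rewrite /D !brPsi !qform_invariant.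
have DpmE X Y : D (fp1 iota X) (fm1 iota Y) = 0.
  by rewrite /D -pm -ppp !PsiE km kpp kp pm ppp ep subrr.
have D0E u v : D (f0 iota u) (f0 iota v) = 0.
  by rewrite /D -!p00 !PsiE !k00 k0 !p00 e0 subrr.
have [_ [_ _ sm] [_ _ s0] [_ _ sp1]] := li.
move=> i u v i1 ui vi; have [|[|]] : i = -1 \/ i = 0 \/ i = 1 by lia.
- move=> ei; move: ui vi; rewrite ei opprK => /sm[Y _ <-] /sp1[X _ <-].
  by rewrite sD.
- by move=> ei; move: ui vi; rewrite ei oppr0 => /s0[Y _ <-] /s0[X _ <-].
by move=> ei; move: ui vi; rewrite ei => /sp1[Y _ <-] /sm[X _ <-].
Qed.

(** The triplet is read off in degrees 0 and 1. The part of degree -1 carries no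
    further information, being dual to degree 1 under the form. *)
Lemma triplet_iso_local (T1 T2 : triplet K) (G : quadGradedLie K)
    (iota1 : local_map (Gamma T1) G) (iota2 : local_map (Gamma T2) G) :
  local_isomorphism iota1 -> extended_form iota1 (@qform K G) ->
  local_isomorphism iota2 -> extended_form iota2 (@qform K G) ->
  triplet_iso T1 T2.
Proof.
move=> li1 [_ _ _ _ [e1 _]] li2 [_ _ _ _ [e2 _]].
have [[[_ /= l01 lp1] [_ /= d01 dp1] [/= b001 _ b0p1 _]] _ bij01 bijp1] := li1.
have [[[_ /= l02 lp2] [_ /= d02 dp2] [/= b002 _ b0p2 _]] _ bij02 bijp2] := li2.
have [_ inj01 injp1] := local_isomorphism_inj li1.
have [_ inj02 injp2] := local_isomorphism_inj li2.
have [q0 [lq0 q0E]] := local_coordinate l02 bij02.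
have [qp [lqp qpE]] := local_coordinate lp2 bijp2.
have AE u : f0 iota2 (q0 (f0 iota1 u)) = f0 iota1 u by rewrite q0E gcomp_id.
have gE X : fp1 iota2 (qp (fp1 iota1 X)) = fp1 iota1 X by rewrite qpE gcomp_id.
exists (q0 \o f0 iota1), (qp \o fp1 iota1); split.
- by split; apply: linear_comp.
- split; apply: bijective_inj_surj.
  + by move=> u v /= e; apply: inj01; rewrite -AE e AE.
  + move=> v; have [_ _ s] := bij01; have [u _ ue] := s _ (d02 v).
    by exists u; apply: inj02; rewrite AE.
  + by move=> u v /= e; apply: injp1; rewrite -gE e gE.
  + move=> v; have [_ _ s] := bijp1; have [u _ ue] := s _ (dp2 v).
    by exists u; apply: injp2; rewrite gE.
- by move=> u v /=; apply: inj02; rewrite AE b002 !AE b001.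
- by move=> u v /=; rewrite -e2 !AE e1.
by move=> u X /=; apply: injp2; rewrite /= gE b0p2 AE gE b0p1.
Qed.

(** In degree -1 the isomorphism acts by the inverse transpose of gamma. *)
Lemma triplet_iso_transport (T1 T2 : triplet K) (G : quadGradedLie K)
    (iota : local_map (Gamma T2) G) : triplet_iso T1 T2 ->
  local_isomorphism iota -> extended_form iota (@qform K G) ->
  exists kappa : local_map (Gamma T1) G,
    local_isomorphism kappa /\ extended_form kappa (@qform K G).
Proof.
move=> [A [gamma [[lA lg] [bA bg] Abr AB Arho]]] li [f1 f2 f3 f4 [e0 ep]].
have [[[/= lm l0 lp] [/= dm d0 dp] [/= b00 b0m b0p bpm]] [_ im sm] [_ i0 s0] [_ ip sp]] := li.
have [delta dK gK] := bg.
have ldelta := inverse_linear lg dK gK.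
have [Delta DeltaE] := linear_hom ldelta; have [Gam GamE] := linear_hom lg.
pose gs (Y : dual (tV T1)) : dual (tV T2) := (Y \o Delta)%VF.
have gsE Y X : gs Y (gamma X) = Y X by rewrite comp_lfunE DeltaE dK.
have gs_eq (Y Y' : dual (tV T2)) : (forall X, Y (gamma X) = Y' (gamma X)) -> Y = Y'.
  by move=> h; apply/lfunP => X; rewrite -(gK X).
have lgs : linear gs.
  by move=> a Y Y'; apply: gs_eq => X; rewrite add_lfunE scale_lfunE !gsE add_lfunE scale_lfunE.
have sgs Y : exists Y', gs Y' = Y.
  exists (Y \o Gam)%VF; apply: gs_eq => X.
  by rewrite gsE comp_lfunE GamE.
have igs : injective gs.
  by move=> Y Y' e; apply/lfunP => X; rewrite -gsE e gsE.
have gs_contra u Y : gs (contragredient u Y) = contragredient (A u) (gs Y).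
  by apply: gs_eq => X; rewrite gsE !contragredientE Arho gsE.
have A_moment X Y : A (moment X Y) = moment (gamma X) (gs Y).
  apply: tB0_inj => u; have [v <-] := bijective_surj bA u.
  by rewrite AB !momentE Arho gsE.
have sA := bijective_surj bA; have sg := bijective_surj bg.
have iA := bij_inj bA; have ig := bij_inj bg.
exists (@LocalMap K (Gamma T1) G (fm1 iota \o gs) (f0 iota \o A) (fp1 iota \o gamma)); split.
  split; first split.
  - by split=> /=; apply: linear_comp.
  - by split=> x /=.
  - split=> /= u v.
    + by rewrite Abr b00.
    + by rewrite gs_contra b0m.
    + by rewrite -Arho b0p.
    + by rewrite A_moment bpm.
  - split=> [x _|x y _ _ /= e|y /sm[Y _ <-]]; first exact: dm.
      by apply: igs; apply: im; rewrite ?in_setT.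
    by have [Y' <-] := sgs Y; exists Y'.
  - split=> [x _|x y _ _ /= e|y /s0[Y _ <-]]; first exact: d0.
      by apply: iA; apply: i0; rewrite ?in_setT.
    by have [Y' <-] := sA Y; exists Y'.
  - split=> [x _|x y _ _ /= e|y /sp[Y _ <-]]; first exact: dp.
      by apply: ig; apply: ip; rewrite ?in_setT.
    by have [Y' <-] := sg Y; exists Y'.
split=> //; split=> [u v|X Y] /=; first by rewrite e0 AB.
by rewrite ep gsE.
Qed.

End MinimalLocal.

(** * The triplet of a transitive quadratic graded Lie algebra *)

Section FiniteDimension.
Variable K : fieldType.

Definition lcomb (L : lmodType K) n (s : 'I_n -> L) (r : 'rV[K]_n) : L :=
  \sum_i r 0 i *: s i.

Lemma lcomb_linear (L : lmodType K) n (s : 'I_n -> L) : linear (lcomb s).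
Proof.
move=> a u v; rewrite /lcomb scaler_sumr -big_split; apply: eq_bigr => i _ /=.
by rewrite !mxE scalerDl scalerA.
Qed.

(** A linear relation with a nonzero i-th coefficient allows s i to be dropped
    from the generators. *)
Lemma lcomb_coordinates (L : lmodType K) n (s : 'I_n -> L) :
  exists m (f : 'rV[K]_m -> L),
    [/\ linear f, injective f & range f = range (lcomb s)]%classic.
Proof.
elim: n s => [|n IH] s.
  exists 0%N, (lcomb s); split=> //; first exact: lcomb_linear.
  by move=> u v _; apply/rowP => -[].
have [inj|] := pselect (injective (lcomb s)).
  by exists n.+1, (lcomb s); split=> //; apply: lcomb_linear.
have ls := lcomb_linear s.
move=> ninj; have [r [rs r0]] : exists r, lcomb s r = 0 /\ r != 0.
  apply: contrapT => nex; apply: ninj => u v e; apply: contrapT => /eqP uv.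
  by apply: nex; exists (u - v); rewrite (linB ls) e subrr subr_eq0.
have [i ri] : exists i, r 0 i != 0.
  apply: contrapT => nex; case/eqP: r0; apply/rowP => i; rewrite mxE.
  by apply: contrapT => /eqP ri; apply: nex; exists i.
have [m [f [lf fi fr]]] := IH (fun j => s (lift i j)).
exists m, f; split=> //; rewrite fr.
have drop (v : 'rV[K]_n.+1) : v 0 i = 0 ->
    lcomb s v = lcomb (fun j => s (lift i j)) (\row_j v 0 (lift i j)).
  move=> vi; rewrite /lcomb (bigD1_ord i) //= vi scale0r add0r.
  by apply: eq_bigr => j _; rewrite mxE.
apply/seteqP; split=> _ [v _ <-].
  exists (\row_j (if unlift i j is Some k then v 0 k else 0)) => //.
  rewrite drop; last by rewrite mxE unlift_none.
  by congr lcomb; apply/rowP => j; rewrite !mxE liftK.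
(* Subtracting a multiple of the relation r kills the i-th coordinate. *)
pose v' := v - (v 0 i / r 0 i) *: r.
exists (\row_j v' 0 (lift i j)) => //; rewrite -drop.
  by rewrite (linB ls) (linZ ls) rs scaler0 subr0.
by rewrite !mxE divfK // subrr.
Qed.

Lemma fin_dim_coordinates (L : lmodType K) (A : set L) : fin_dim A ->
  exists n (f : 'rV[K]_n -> L), [/\ linear f, injective f & range f = A]%classic.
Proof.
move=> [s ->]; have [n [f [lf fi fr]]] := lcomb_coordinates (fun i : 'I_(size s) => s`_i).
exists n, f; split=> //; rewrite fr; have lc := lcomb_linear (fun i : 'I_(size s) => s`_i).
apply/seteqP; split=> [_ [r _ <-]|].
  apply: (subspace_sum (lspan_subspace _)) => i _.
  by apply: (subspaceZ (lspan_subspace _)); apply: mem_lspan; apply: mem_nth.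
apply: lspan_min => [|x /= xs]; first exact: image_subspace.
have xi : (index x s < size s)%N by rewrite index_mem.
exists (delta_mx 0 (Ordinal xi)) => //; rewrite /lcomb (bigD1 (Ordinal xi)) //=.
rewrite !mxE !eqxx scale1r nth_index // big1 ?addr0 // => j ji.
by rewrite !mxE eqxx (negbTE ji) scale0r.
Qed.

(** The two injections V -> U* and U -> V* force the dimensions to agree. *)
Lemma perfect_pairing (U V : vectType K) (b : U -> V -> K) :
  (forall u, scalar (b u)) -> (forall v, scalar (fun u => b u v)) ->
  (forall u, (forall v, b u v = 0) -> u = 0) ->
  (forall v, (forall u, b u v = 0) -> v = 0) ->
  forall phi : dual U, exists v, forall u, b u v = phi u.
Proof.
have half (U' V' : vectType K) (c : U' -> V' -> K) :
    (forall u, scalar (c u)) -> (forall v, scalar (fun u => c u v)) ->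
    (forall v, (forall u, c u v = 0) -> v = 0) ->
    exists F : 'Hom(V', dual U'), lker F = 0%VS /\ forall u v, F v u = c u v.
  move=> lr ll nd.
  have /choice[f fE] : forall v, exists phi : dual U', forall u, phi u = c u v.
    by move=> v; apply: linear_hom; apply: ll.
  have lf : linear f.
    move=> a v w; apply/lfunP => u.
    by rewrite add_lfunE scale_lfunE !fE lr.
  have [F FE] := linear_hom lf.
  exists F; split; last by move=> u v; rewrite FE fE.
  apply/eqP/lker0P => v w e; apply/eqP; rewrite -subr_eq0; apply/eqP; apply: nd => u.
  rewrite (linB (scalar_linear (lr u))) -!fE -!FE e; exact: subrr.
move=> lr ll ndl ndr phi.
have [F [kF FE]] := half U V b lr ll ndr.
have [F' [kF' _]] := half V U (fun v u => b u v) ll lr ndl.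
have dF := limg_ker_dim F fullv; have dF' := limg_ker_dim F' fullv.
rewrite kF capv0 dimv0 add0n in dF; rewrite kF' capv0 dimv0 add0n in dF'.
have le1 := dimvS (subvf (limg F)); have le2 := dimvS (subvf (limg F')).
rewrite dF in le1; rewrite dF' in le2.
have FT : limg F = fullv.
  apply/eqP; rewrite eqEdim subvf /= dF.
  by move: le1 le2; rewrite !dimvf /dim /= !muln1.
have : phi \in limg F by rewrite FT memvf.
by move=> /memv_imgP[v _ ->]; exists v => u; rewrite FE.
Qed.

(** Enlarge a subspace inside S by one vector at a time until it fills S. *)
Lemma subspace_vspace (V : vectType K) (S : set V) : subspace S ->
  exists U : {vspace V}, forall x, S x <-> x \in U.
Proof.
move=> sS.
have grow (n : nat) (U : {vspace V}) : (\dim {:V} - \dim U <= n)%N ->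
    (forall x, x \in U -> S x) -> exists U' : {vspace V}, forall x, S x <-> x \in U'.
  elim: n U => [|n IH] U dU US; have [sub|nsub] := pselect (forall x, S x -> x \in U);
    try by exists U => x; split=> [/sub|/US].
    case: nsub => x _; suff -> : U = fullv by apply: memvf.
    by apply/eqP; rewrite eqEdim subvf /=; move: dU; rewrite leqn0 subn_eq0.
  have [x Sx xU] : exists2 x, S x & x \notin U.
    apply: contrapT => nex; apply: nsub => x Sx; apply: contrapT => /negP xU.
    by apply: nex; exists x.
  apply: (IH (U + <[x]>)%VS); last first.
    move=> _ /memv_addP[u uU [w /vlineP[a ->] ->]].
    by apply: (subspaceD sS); [apply: US|apply: (subspaceZ sS)].
  have : (\dim U < \dim (U + <[x]>))%N.
    rewrite ltn_neqAle dimvS ?addvSl // andbT; apply: contra xU => /eqP e.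
    have : (U == U + <[x]>)%VS by rewrite eqEdim addvSl e leqnn.
    by move=> /eqP UE; rewrite memvE [X in (_ <= X)%VS]UE addvSr.
  by have := dimvS (subvf (U + <[x]>)%VS); lia.
apply: (grow _ 0%VS (leqnn _)) => x; rewrite memv0 => /eqP ->; exact: subspace0.
Qed.

(** psi - psi o proj_U vanishes on U, for every functional psi. *)
Lemma subspace_annihilator (V : vectType K) (S : set V) : subspace S ->
  (forall phi : dual V, (forall x, S x -> phi x = 0) -> phi = 0) -> S = setT.
Proof.
move=> sS h; have [U US] := subspace_vspace sS.
apply/seteqP; split=> // x _; apply/US.
suff /eqP : x - projv U x = 0 by rewrite subr_eq0 => /eqP ->; apply: memv_proj.
apply: dual_separates => psi.
have -> : psi (x - projv U x) = (psi \o (\1 - projv U))%VF x.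
  by rewrite comp_lfunE add_lfunE opp_lfunE id_lfunE.
rewrite (h (psi \o (\1 - projv U))%VF) ?zero_lfunE // => y /US yU.
by rewrite comp_lfunE add_lfunE opp_lfunE id_lfunE projv_id // subrr linear0.
Qed.

End FiniteDimension.

Section TripletOfAlgebra.
Variables (K : fieldType) (G : quadGradedLie K).

Lemma degree_pairing i (x : G) : gdeg i x ->
  (forall y, gdeg (- i) y -> qform x y = 0) -> x = 0.
Proof.
move=> xi h; apply: (@qform_nondegenerate _ G) => y.
by rewrite -(form_gcomp (@qform_bilinear _ G) (@qform_orthogonal _ G) y xi) h //; apply: gcompP.
Qed.

Lemma set_bij_range (U : lmodType K) (f : U -> G) i :
  injective f -> range f = gdeg i -> set_bij setT (gdeg i) f.
Proof.
move=> fi <-; split=> [x _|x y _ _ /fi//|_ [x _ <-]]; first by exists x.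
by exists x.
Qed.

(** In coordinates on degrees 0 and 1. Degree -1 is identified with the dual of
    degree 1 by the form, under which the moment map becomes the bracket. A
    functional that vanishes on <g_0.V> is an element of degree -1 that commutes
    with degree 1, and one that vanishes on <g_0.V*> is an element of degree 1
    that commutes with degree -1; both are 0 by transitivity. *)
Lemma triplet_of_algebra : transitive_graded G ->
  exists (T : triplet K) (kappa : local_map (Gamma T) G),
    [/\ admissible T, local_isomorphism kappa & extended_form kappa (@qform K G)].
Proof.
move=> [trp trm].
have [n [f0 [l0 i0 r0]]] := fin_dim_coordinates (@gdeg_fin_dim _ G 0).
have [m [fp [lp ip rp]]] := fin_dim_coordinates (@gdeg_fin_dim _ G 1).
have [k [fn [ln i_n rn]]] := fin_dim_coordinates (@gdeg_fin_dim _ G (-1)).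
have b0 := set_bij_range i0 r0; have bp := set_bij_range ip rp.
have bn := set_bij_range i_n rn.
have [q0 [lq0 q0E]] := local_coordinate l0 b0.
have [qp [lqp qpE]] := local_coordinate lp bp.
have d0 u : gdeg 0 (f0 u) by rewrite -r0; exists u.
have dp x : gdeg 1 (fp x) by rewrite -rp; exists x.
have dn x : gdeg (-1) (fn x) by rewrite -rn; exists x.
have s0 y : gdeg 0 y -> exists u, f0 u = y by rewrite -r0 => -[u _ <-]; exists u.
have sp y : gdeg 1 y -> exists u, fp u = y by rewrite -rp => -[u _ <-]; exists u.
have sn y : gdeg (-1) y -> exists u, fn u = y by rewrite -rn => -[u _ <-]; exists u.
have [bG sG iG oG] := And4 (@qform_bilinear _ G) (@qform_symmetric _ G)
  (@qform_invariant _ G) (@qform_orthogonal _ G).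
have lr := form_linr bG; have ll := form_linl bG.
pose br0 u v := q0 \[f0 u, f0 v\].
have br0E u v : f0 (br0 u v) = \[f0 u, f0 v\].
  by rewrite /br0 q0E gcomp_id //; apply: gdeg_bracket0.
have br0_r u : linear (br0 u).
  by move=> a x y; apply: i0; rewrite l0 !br0E l0 br_linr.
have br0_l v : linear (br0^~ v).
  by move=> a x y; apply: i0; rewrite l0 !br0E l0 br_linl.
have br0xx u : br0 u u = 0 by apply: i0; rewrite br0E bracketxx (lin0 l0).
have br0_jac x y z : br0 x (br0 y z) + br0 y (br0 z x) + br0 z (br0 x y) = 0.
  by apply: i0; rewrite !(linD l0) !br0E bracket_jacobi (lin0 l0).
pose g0 : finLieType K := HB.pack 'rV[K]_n
  (Lmodule_isLie.Build K 'rV[K]_n br0_r br0_l br0xx br0_jac).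
pose V : vectType K := 'rV[K]_m.
have actE u x : fp (qp \[f0 u, fp x\]) = \[f0 u, fp x\].
  by rewrite qpE gcomp_id //; apply: gdeg_bracket0.
have /choice[rho rhoE] : forall u : g0, exists F : 'End(V),
    forall x, fp (F x) = \[f0 u, fp x\].
  move=> u; have lF : linear (fun x => qp \[f0 u, fp x\]).
    by move=> a x y; apply: ip; rewrite [RHS]lp !actE lp br_linr.
  by have [F FE] := linear_hom lF; exists F => x; rewrite FE actE.
pose B0 (u v : g0) : K := qform (f0 u) (f0 v).
have B0_bil : bilinear_form B0.
  by split=> x a y z; rewrite /B0 l0; [apply: bG.1|apply: bG.2].
have B0_sym : symmetric_form B0 by move=> u v; apply: sG.
have B0_inv : invariant_form B0.
  by move=> u v w; rewrite /B0 -[\[u, v\]]/(br0 u v) -[\[v, w\]]/(br0 v w) !br0E iG.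
have B0_nd : nondegenerate_form B0.
  move=> u h; apply: i0; rewrite (lin0 l0); apply: (degree_pairing (d0 u)) => y.
  by rewrite oppr0 => /s0[v <-]; apply: h.
have rho_lin : linear rho.
  move=> a u v; apply/lfunP => x; apply: ip.
  by rewrite add_lfunE scale_lfunE lp !rhoE l0 br_linl.
have rho_br u v : rho \[u, v\] = ((rho u \o rho v) - (rho v \o rho u))%VF.
  apply/lfunP => x; apply: ip; rewrite add_lfunE opp_lfunE !comp_lfunE (linB lp).
  by rewrite !rhoE -[\[u, v\]]/(br0 u v) br0E br_leibniz addrK.
pose T := @Triplet K g0 B0 V rho B0_bil B0_sym B0_inv B0_nd rho_lin rho_br.
have pair_lr x : scalar (fun y => qform (fp x) (fn y)).
  by move=> a y z; rewrite ln; apply: bG.1.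
have pair_ll y : scalar (fun x => qform (fp x) (fn y)).
  by move=> a x z; rewrite lp; apply: bG.2.
have ndp x : (forall y, qform (fp x) (fn y) = 0) -> x = 0.
  move=> h; apply: ip; rewrite (lin0 lp); apply: (degree_pairing (dp x)) => y.
  by move=> /sn[z <-]; apply: h.
have ndm y : gdeg (-1) y -> (forall x, qform (fp x) y = 0) -> y = 0.
  move=> ym h; apply: (degree_pairing ym) => z.
  by rewrite opprK => /sp[x <-]; rewrite sG.
have ndn y : (forall x, qform (fp x) (fn y) = 0) -> y = 0.
  by move=> h; apply: i_n; rewrite (lin0 ln); apply: ndm.
have /choice[fm fmP] : forall Y : dual V, exists y : G,
    gdeg (-1) y /\ forall x, qform (fp x) y = Y x.
  move=> Y; have [v vY] := @perfect_pairing _ V 'rV[K]_k _ pair_lr pair_ll ndp ndn Y.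
  by exists (fn v).
have dm Y := (fmP Y).1; have fmE Y := (fmP Y).2.
have fm_unique y y' : gdeg (-1) y -> gdeg (-1) y' ->
    (forall x, qform (fp x) y = qform (fp x) y') -> y = y'.
  move=> ym ym' h; apply/eqP; rewrite -subr_eq0; apply/eqP; apply: ndm.
    by apply: subspaceB => //; apply: gdeg_subspace.
  by move=> x; rewrite (linB (lr _)) h; apply: subrr.
have lm : linear fm.
  move=> a Y Z; apply: fm_unique => //.
    have sm := @gdeg_subspace _ G (-1).
    by apply: (subspaceD sm) => //; apply: (subspaceZ sm).
  by move=> x; rewrite fmE add_lfunE scale_lfunE bG.1 !fmE.
have im : injective fm.
  by move=> Y Z e; apply/lfunP => x; rewrite -!fmE e.
have sm y : gdeg (-1) y -> exists Y, fm Y = y.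
  move=> ym; have [Y YE] : exists Y : dual V, forall x, Y x = qform (fp x) y.
    by apply: linear_hom => a x z; rewrite lp; apply: bG.2.
  by exists Y; apply: fm_unique => // x; rewrite fmE YE.
have momE X Y : f0 (@moment _ T X Y) = \[fp X, fm Y\].
  have c0 : gdeg 0 \[fp X, fm Y\] by apply: gdegS (gdeg_bracket (dp X) (dm Y)) _.
  apply/eqP; rewrite -subr_eq0; apply/eqP; apply: (@degree_pairing 0).
    by apply: subspaceB => //; apply: gdeg_subspace.
  move=> y; rewrite oppr0 => /s0[v <-]; rewrite (linB (ll _)).
  have -> : qform (f0 (@moment _ T X Y)) (f0 v) = Y (rho v X) by apply: (@momentE _ T).
  have -> : qform \[fp X, fm Y\] (f0 v) = Y (rho v X).
    by rewrite sG -iG -rhoE fmE.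
  exact: subrr.
have contraE u Y : fm (@contragredient _ T u Y) = \[f0 u, fm Y\].
  apply: fm_unique => //; first exact: gdeg_bracket0.
  move=> X; rewrite fmE (@contragredientE _ T) -iG br_anti (linN (ll _)) -rhoE.
  by rewrite fmE.
pose kappa := @LocalMap K (Gamma T) G fm f0 fp.
have act0 (u : g0) (Y : dual V) (X : V) : Y (rho u X) = qform (f0 u) \[fp X, fm Y\].
  by rewrite -iG -rhoE fmE.
have adm : admissible T.
  split.
  - move=> u v /= e; apply: i0; apply/eqP; rewrite -subr_eq0 -(linB l0); apply/eqP.
    apply: (trm 0) => // y /sp[X <-].
    by rewrite (linB l0) brDl brNl -!rhoE e subrr.
  - apply: subspace_annihilator => [|Y h]; first exact: lspan_subspace.
    apply: im; rewrite (lin0 lm); apply: (trm (-1)) => // y /sp[X <-].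
    rewrite br_anti; apply/eqP; rewrite oppr_eq0; apply/eqP.
    apply: (@degree_pairing 0); first by apply: gdegS (gdeg_bracket (dp X) (dm Y)) _.
    move=> y'; rewrite oppr0 => /s0[u <-]; rewrite sG -act0.
    by apply: h; apply: mem_lspan; exists u, X.
  apply: subspace_annihilator => [|Phi h]; first exact: lspan_subspace.
  have [X XE] : exists X : V, forall Y : dual V, Y X = Phi Y.
    apply: (@perfect_pairing _ (dual V) V (fun Y X => Y X)).
    - by move=> Y a x y; rewrite linearP.
    - by move=> x a Y Z; rewrite add_lfunE scale_lfunE.
    - by move=> Y hY; apply/lfunP => x; rewrite hY zero_lfunE.
    exact: dual_separates.
  suff X0 : X = 0 by apply/lfunP => Y; rewrite -XE X0 linear0 zero_lfunE.
  apply: ip; rewrite (lin0 lp); apply: (trp 1) => // y /sm[Y <-].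
  apply: (@degree_pairing 0); first by apply: gdegS (gdeg_bracket (dp X) (dm Y)) _.
  move=> y'; rewrite oppr0 => /s0[u <-]; rewrite sG -act0.
  have : Phi (@contragredient _ T u Y) = 0 by apply: h; apply: mem_lspan; exists u, Y.
  by rewrite -XE (@contragredientE _ T) => /eqP; rewrite oppr_eq0 => /eqP.
exists T, kappa; split=> //.
  split=> //.
  split=> [Y _|Y Z _ _ e|y /sm[Y <-]]; [exact: dm|exact: (im Y Z e)|].
  by exists Y.
Qed.

End TripletOfAlgebra.

(** * The bijection on isomorphism classes *)

Section Classes.
Variable K : fieldType.
Implicit Types (T : triplet K) (G : quadGradedLie K).

Lemma triplet_iso_refl T : triplet_iso T T.
Proof. by exists id, id; split=> //; split; exists id. Qed.

Lemma triplet_iso_sym T1 T2 : triplet_iso T1 T2 -> triplet_iso T2 T1.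
Proof.
move=> [A [gamma [[lA lg] [[A' AK A'K] [g' gK g'K]] Abr AB Arho]]].
exists A', g'; split.
- by split; [apply: inverse_linear lA AK A'K|apply: inverse_linear lg gK g'K].
- by split; [exists A|exists gamma].
- by move=> u v; apply: (can_inj AK); rewrite Abr !A'K.
- by move=> u v; rewrite -AB !A'K.
by move=> u X; apply: (can_inj gK); rewrite -Arho A'K !g'K.
Qed.

Lemma triplet_iso_trans T1 T2 T3 :
  triplet_iso T1 T2 -> triplet_iso T2 T3 -> triplet_iso T1 T3.
Proof.
move=> [A [gamma [[lA lg] [bA bg] Abr AB Arho]]].
move=> [C [delta [[lC ld] [bC bd] Cbr CB Crho]]].
exists (C \o A), (delta \o gamma); split.
- by split; apply: linear_comp.
- by split; apply: bij_comp.
- by move=> u v /=; rewrite Abr Cbr.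
- by move=> u v /=; rewrite CB AB.
by move=> u X /=; rewrite Crho Arho.
Qed.

Lemma quad_iso_refl G : quad_iso G G.
Proof. by exists id; split=> //; exists id. Qed.

Lemma quad_iso_sym G1 G2 : quad_iso G1 G2 -> quad_iso G2 G1.
Proof.
move=> [Psi [[lP dP bP] [Psi' PK P'K] qP]]; exists Psi'.
have lP' := inverse_linear lP PK P'K.
split; [split=> // | by exists Psi | by move=> x y; rewrite -qP !P'K].
- move=> i x xi; rewrite -(P'K x) in xi.
  have mP : graded_morphism Psi by [].
  have : Psi (gcomp i (Psi' x)) = Psi (Psi' x) by rewrite (morphism_gcomp mP) gcomp_id.
  by move=> /(can_inj PK) <-; apply: gcompP.
- by move=> x y; apply: (can_inj PK); rewrite bP !P'K.
Qed.

Lemma quad_iso_trans G1 G2 G3 : quad_iso G1 G2 -> quad_iso G2 G3 -> quad_iso G1 G3.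
Proof.
move=> [P [mP bP qP]] [Q [mQ bQ qQ]]; exists (Q \o P); split.
- exact: morphism_comp.
- exact: bij_comp.
by move=> x y /=; rewrite qQ qP.
Qed.

Lemma triplet_class_eq T1 T2 (h1 : admissible T1) (h2 : admissible T2) :
  triplet_class h1 = triplet_class h2 <-> triplet_iso T1 T2.
Proof.
split=> [[e]|iso]; first by rewrite e; apply: triplet_iso_refl.
apply: eq_exist; apply/funext => T; apply/propext; split.
  by apply: triplet_iso_trans; apply: triplet_iso_sym.
exact: triplet_iso_trans.
Qed.

Lemma graded_class_eq G1 G2 (h1 : transitive_graded G1) (h2 : transitive_graded G2) :
  graded_class h1 = graded_class h2 <-> quad_iso G1 G2.
Proof.
split=> [[e]|iso]; first by rewrite e; apply: quad_iso_refl.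
apply: eq_exist; apply/funext => T; apply/propext; split.
  by apply: quad_iso_trans; apply: quad_iso_sym.
exact: quad_iso_trans.
Qed.

Lemma triplet_classP (c : triplet_classes K) :
  exists T (h : admissible T), c = triplet_class h.
Proof.
by case: c => c hc; have [T h cT] := hc; exists T, h; apply: eq_exist.
Qed.

Lemma graded_classP (c : graded_classes K) :
  exists G (h : transitive_graded G), c = graded_class h.
Proof.
by case: c => c hc; have [T h cT] := hc; exists T, h; apply: eq_exist.
Qed.

(** From left to right, the local part of T2 is transported to T1, whose minimal
    algebra is unique; from right to left, the local part determines the
    triplet. *)
Lemma gmin_with_form_iso T1 T2 G1 G2 :
  transitive_graded G1 -> transitive_graded G2 ->
  is_gmin_with_form T1 G1 -> is_gmin_with_form T2 G2 ->
  triplet_iso T1 T2 <-> quad_iso G1 G2.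
Proof.
move=> tr1 tr2 [iota1 [g1 e1]] [iota2 [g2 e2]].
have l1 := gmin_local_isomorphism g1; have l2 := gmin_local_isomorphism g2.
split=> [iso|[Psi [mP bP qP]]].
  have [kappa [lk ek]] := triplet_iso_transport iso l2 e2.
  exact: (gmin_unique g1 e1 tr1 lk ek tr2).
have sP : set_surj setT setT Psi.
  by move=> y _; have [x <-] := bijective_surj bP y; exists x.
have lk : local_isomorphism (local_map_comp Psi iota1).
  apply: local_isomorphism_injective => // x _ Px; apply: (bij_inj bP).
  by case: mP => lP _ _; rewrite Px (lin0 lP).
apply: (triplet_iso_local lk _ l2 e2).
case: e1 => _ _ _ _ [e0 ep]; split.
- exact: qform_bilinear.
- exact: qform_symmetric.
- exact: qform_invariant.
- exact: qform_orthogonal.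
by split=> [u v|X Y] /=; rewrite qP.
Qed.

Theorem gmin_classification :
  exists tau : triplet_classes K -> graded_classes K,
    (forall T (hT : admissible T), exists G (hG : transitive_graded G),
       is_gmin_with_form T G /\ tau (triplet_class hT) = graded_class hG) /\
    (forall T (hT : admissible T) G (hG : transitive_graded G),
       is_gmin_with_form T G -> tau (triplet_class hT) = graded_class hG) /\
    bijective tau.
Proof.
have /choice[tau tauP] : forall c : triplet_classes K, exists d : graded_classes K,
    exists T (hT : admissible T) G (hG : transitive_graded G),
      [/\ is_gmin_with_form T G, c = triplet_class hT & d = graded_class hG].
  move=> c; have [T [hT ->]] := triplet_classP c.
  by have [G [gG hG]] := gmin_exists hT; exists (graded_class hG), T, hT, G, hG.
have tauE T (hT : admissible T) G (hG : transitive_graded G) :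
    is_gmin_with_form T G -> tau (triplet_class hT) = graded_class hG.
  move=> gG; have [T' [hT' [G' [hG' [gG' e ->]]]]] := tauP (triplet_class hT).
  by apply/graded_class_eq/(gmin_with_form_iso hG' hG gG' gG)/(triplet_class_eq hT' hT).
exists tau; split=> [T hT|]; first last.
  split=> //; apply: bijective_inj_surj => [c1 c2|d].
    have [T1 [h1 [G1 [k1 [g1 -> ->]]]]] := tauP c1.
    have [T2 [h2 [G2 [k2 [g2 -> ->]]]]] := tauP c2.
    by move=> /graded_class_eq/(gmin_with_form_iso k1 k2 g1 g2)/triplet_class_eq.
  have [G [hG ->]] := graded_classP d.
  have [T [kappa [hT lk ek]]] := triplet_of_algebra hG.
  have [G' [[iota [gi ei]] hG']] := gmin_exists hT.
  exists (triplet_class hT); rewrite (tauE _ hT _ hG'); last by exists iota.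
  exact/graded_class_eq/(gmin_unique gi ei hG' lk ek hG).
by have [G [gG hG]] := gmin_exists hT; exists G, hG; split=> //; apply: tauE.
Qed.

End Classes.

Theorem theorem3p5p4 (R : realType) :
  exists tau : triplet_classes R[i] -> graded_classes R[i],
    (forall (T : triplet R[i]) (hT : admissible T),
       exists (G : quadGradedLie R[i]) (hG : transitive_graded G),
         is_gmin_with_form T G /\ tau (triplet_class hT) = graded_class hG) /\
    (forall (T : triplet R[i]) (hT : admissible T)
            (G : quadGradedLie R[i]) (hG : transitive_graded G),
       is_gmin_with_form T G -> tau (triplet_class hT) = graded_class hG) /\
    bijective tau.
Proof. exact: gmin_classification. Qed.
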